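(* Let $(X,V)$ have density $f_0(x,v)=g_1(x)\lambda e^{-\lambda v}$ on $[0,\infty)^2$, let $$\rho(y,v)=\frac1{g_1(y)}\int_0^y g_1(u)g_2(v+y-u)\,du-\overline G_2(v),$$ and assume $C_0:=\mathbb E[\rho(X,V)^2]<\infty$. Under the IEBP policy, the number of jobs Alice can insert covertly is $T(n)=\mathcal O(\sqrt n)$ if $\mathbb E[\rho(X,V)]=0$, and $T(n)=\mathcal O(1)$ if $\mathbb E[\rho(X,V)]\neq0$. (The meaning of ''can insert covertly'' is given in the context.)
   Context: Model. Willie's jobs arrive according to a Poisson process of rate $\lambda\in(0,\infty)$ to a single-server FIFO queue, empty at time $0$. Willie's service times are iid with continuous density $g_1$ and finite mean $1/\mu_1>0$; Alice's service times are iid with continuous density $g_2$, cdf $G_2$, $\overline G_2=1-G_2$, and finite mean $1/\mu_2>0$; service times and arrivals are mutually independent; $\lambda/\mu_1<1$. Alice's jobs cannot be preempted once in service. Let $A_i,D_i$ be the arrival and departure times of Willie's $i$-th job, $D_0=0$. The reconstructed service times are $S_1=D_1-A_1$ and $S_i=D_i-\max\{A_i,D_{i-1}\}$ for $i\ge2$. A Willie Busy Period (W-BP) is the time interval from the arrival of a Willie job finding no other Willie job in the system to the first subsequent departure of a Willie job leaving no other Willie job in the system. Let $M_0=0$, $M_j=\min\{i>M_{j-1}:A_{i+1}>D_i\}$. IEBP policy with parameter $q\in[0,1]$: at the end of each W-BP (time $0$ being treated as such an end), Alice independently inserts one job with probability $q$, and otherwise inserts none until the end of the next W-BP. $H_0$: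 Alice inserts no jobs. $H_1$: Alice uses IEBP with $q=q(n)$, where $n$ is the number of W-BPs observed by Willie. $T(n)=nq(n)$ is the expected number of jobs Alice inserts in $n$ W-BPs. Let $Y_j=S_{M_{j-1}+1}$ (reconstructed service time of the first Willie job in the $j$-th W-BP) and $V_j=A_{M_{j-1}+1}-D_{M_{j-1}}$ (preceding idle period). Under either hypothesis the pairs $(Y_j,V_j)$, $j=1,\dots,n$, are iid; $f_i$ denotes their common density under $H_i$. Under $H_0$, $f_0(y,v)=g_1(y)\lambda e^{-\lambda v}$. Under $H_1$, $(Y,V)$ is distributed as $(\sigma_1+\mathbf 1_A(\sigma_2-V)^+,V)$ with $\sigma_1\sim g_1$, $\sigma_2\sim g_2$, $V$ exponential with rate $\lambda$ and $P(A)=q$, all independent. The function $\rho(y,v)$ is defined where $g_1(y)>0$, which has full probability under $X\sim g_1$. $f^{\otimes n}$ is the $n$-fold tensor product density, and $T_V(u_0,u_1)=\frac12\int|u_0-u_1|$. Willie uses an optimal test on $(Y_{1:n},V_{1:n})$, for which the minimum of (false alarm probability + missed detection probability) is $P_E^\star=1-T_V(f_0^{\otimes n},f_1^{\otimes n})$. Covertness. Alice's insertions are covert if for any $\epsilon>0$ she has an insertion strategy $(q(n))_n$ such that $\liminf_nP_E^\star\ge1-\epsilon$, equivalently $\limsup_nT_V(f_0^{\otimes n},f_1^{\otimes n})\le\epsilon$. Explicitly: ''the number of jobs Alice can insert covertly is $T(n)=\mathcal O(b_n)$'' means that for every $\phi:\{1,2,\dots\}\to[1,\infty)$ with $n/\phi(n)=\mathcal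 O(b_n)$ and every $\epsilon>0$ there is $\delta\in(0,1]$ such that with $q(n)=\delta/\phi(n)$ (so $T(n)=\delta n/\phi(n)$) one has $\limsup_nT_V(f_0^{\otimes n},f_1^{\otimes n})\le\epsilon$. *)

(* Defs.v *)
(* MathComp-Analysis, over an arbitrary R : realType. *)
From HB Require Import structures.
From mathcomp Require Import all_boot all_order all_algebra.
From mathcomp Require Import all_classical all_reals all_analysis.

Set Implicit Arguments.
Unset Strict Implicit.
Unset Printing Implicit Defensive.

Import Order.TTheory GRing.Theory Num.Theory.
Import numFieldNormedType.Exports.

Local Open Scope classical_set_scope.
Local Open Scope ring_scope.

Definition has_density d d' (T : measurableType d) (E : measurableType d')
    (R : realType) (P : probability T R) (nu : set E -> \bar R)
    (Z : T -> E) (f : E -> R) : Prop :=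
  [/\ measurable_fun [set: E] f,
      forall z, 0 <= f z &
      forall B : set E, measurable B ->
        P (Z @^-1` B) = (\int[nu]_(z in B) (f z)%:E)%E].

Definition mutually_independent d (T : measurableType d) (R : realType)
    (P : probability T R) (I : eqType) (Z : I -> T -> R) : Prop :=
  forall s : seq I, uniq s ->
  forall B : I -> set R, (forall i, measurable (B i)) ->
    P (\bigcap_(i in [set` s]) (Z i @^-1` B i)) =
    (\prod_(i <- s) P (Z i @^-1` B i))%E.

(* Continuous density of a service time with mean [m]; it is carried by
   [0, +oo[, and continuity is required only there, so that, for example,
   exponential densities are allowed. *)
Record service_density (R : realType) (g : R -> R) (m : R) : Prop := {
  service_density_ge0 : forall x, 0 <= g x ;
  service_density_neg : forall x, x < 0 -> g x = 0 ;
  service_density_continuous : {within `[0, +oo[, continuous g} ;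
  service_density_mass :
    (\int[lebesgue_measure]_(x in `[0%R, +oo[) (g x)%:E = 1)%E ;
  service_density_mean :
    (\int[lebesgue_measure]_(x in `[0%R, +oo[) (x * g x)%:E = m%:E)%E }.

(* The primitive randomness.  Willie's jobs and the Willie busy periods (W-BPs)
   are numbered from 1; the entries of index 0 play no role. *)
Record queue_inputs d (T : measurableType d) (R : realType) := QueueInputs {
  gap : nat -> {mfun T >-> R} ;     (* interarrival time before Willie's job i *)
  wservice : nat -> {mfun T >-> R} ;      (* service time of Willie's job i *)
  aservice : nat -> {mfun T >-> R} ;  (* service time of Alice's job, if one is
                                         inserted just before the j-th W-BP *)
  coin : nat -> {mfun T >-> bool} }.  (* does Alice insert that job? *)

Section IEBP_queue.
Context d (T : measurableType d) (R : realType) (U : queue_inputs T R).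
Implicit Types (w : T) (i j k : nat).

Definition all_inputs (k : (nat + nat) + (nat + nat)) : T -> R :=
  match k with
  | inl (inl i) => gap U i
  | inl (inr i) => wservice U i
  | inr (inl j) => aservice U j
  | inr (inr j) => fun w => (coin U j w)%:R
  end.

(* A Poisson process of rate [lam] is described by its iid exponential
   interarrival times. *)
Record IEBP_law (P : probability T R) (lam : R) (g1 g2 : R -> R) (q : R) :
    Prop := {
  gap_law : forall i, (1 <= i)%N ->
    has_density P lebesgue_measure (gap U i) (exponential_pdf lam) ;
  wservice_law : forall i, (1 <= i)%N ->
    has_density P lebesgue_measure (wservice U i) g1 ;
  aservice_law : forall j, (1 <= j)%N ->
    has_density P lebesgue_measure (aservice U j) g2 ;
  coin_law : forall j, (1 <= j)%N -> P [set w | coin U j w] = q%:E ;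
  inputs_independent : mutually_independent P all_inputs }.

Definition arrival i w : R := \sum_(1 <= k < i.+1) gap U k w.

(* [(D_i, number of W-BPs begun by Willie's jobs 1..i)].  Willie's job k+1 begins
   a new W-BP when it arrives after [D_k]; if Alice then had inserted a job, that
   job entered service at [D_k], the server being idle, and [free] is the time at
   which the server is done with everything ahead of Willie's job k+1. *)
Fixpoint queue_state i w : R * nat :=
  match i with
  | 0 => (0, 0%N)
  | k.+1 =>
      let: (Dk, j) := queue_state k w in
      let new := Dk < arrival k.+1 w in
      let free := if new && coin U j.+1 w then Dk + aservice U j.+1 w else Dk in
      (Num.max (arrival k.+1 w) free + wservice U k.+1 w,
       if new then j.+1 else j)
  end.

Definition departure i w : R := (queue_state i w).1.

Definition reconstructed i w : R :=
  if (i <= 1)%N then departure i w - arrival i w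
  else departure i w - Num.max (arrival i w) (departure i.-1 w).

(* Least element of a set of naturals, and 0 for the empty set. *)
Definition least (p : pred nat) : nat :=
  if pselect (exists i, p i) is left h then ex_minn h else 0%N.

(* [M_j], the index of the job that ends the j-th W-BP.  The busy periods are
   almost surely finite, so that the default value of [least] is reached with
   probability zero. *)
Fixpoint last_job j w : nat :=
  match j with
  | 0 => 0%N
  | k.+1 => least (fun i => (last_job k w < i)%N &&
                            (departure i w < arrival i.+1 w))
  end.

Definition first_service j w : R := reconstructed (last_job j.-1 w).+1 w.

Definition idle_period j w : R :=
  arrival (last_job j.-1 w).+1 w - departure (last_job j.-1 w) w.

Definition observation j w : R * R := (first_service j w, idle_period j w).

End IEBP_queue.

Definition lebesgue2 (R : realType) :
    set (measurableTypeR R * measurableTypeR R) -> \bar R :=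
  (@lebesgue_measure R \x @lebesgue_measure R)%E.
Arguments lebesgue2 : clear implicits.

Section covertness.
Context (R : realType).
Implicit Types (lam q : R) (g : R -> R).

Definition null_density g1 lam (z : R * R) : R :=
  g1 z.1 * exponential_pdf lam z.2.

Definition tail g (v : R) : R :=
  1 - \int[lebesgue_measure]_(u in `[0, v]) g u.

(* Meaningful where [g1 y != 0]; elsewhere the first term is 0 by convention. *)
Definition rho g1 g2 (y v : R) : R :=
  (g1 y)^-1 * (\int[lebesgue_measure]_(u in `[0, y]) (g1 u * g2 (v + y - u)))
  - tail g2 v.

(* Integral with respect to the n-fold power of [nu], as an iterated integral;
   the two agree for nonnegative measurable functions and sigma-finite [nu], by
   Tonelli's theorem. *)
Fixpoint integral_power d (E : measurableType d) (nu : set E -> \bar R) (n : nat) :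
    (n.-tuple E -> \bar R) -> \bar R :=
  match n with
  | 0 => fun F => F [tuple]
  | m.+1 => fun F =>
      (\int[nu]_x integral_power nu (fun t : m.-tuple E => F [tuple of x :: t]))%E
  end.

Definition tensor_density (E : Type) (f : E -> R) (n : nat)
    (t : n.-tuple E) : R := \prod_(i < n) f (tnth t i).

Definition tv_distance d (E : measurableType d) (nu : set E -> \bar R)
    (n : nat) (u0 u1 : n.-tuple E -> R) :
    \bar R :=
  ((2^-1)%:E * integral_power nu (fun t => `|u0 t - u1 t|%:E))%E.

(* Alice can covertly insert O(b_n) jobs.  [f1 q] is the density of one
   observation when she inserts with probability [q]; with [q(n) = delta/phi(n)]
   she inserts [T(n) = delta * n/phi(n)] jobs on average. *)
Definition covertly_inserts_bigO (f0 : R * R -> R) (f1 : R -> R * R -> R)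
    (b : nat -> R) : Prop :=
  forall phi : nat -> R, (forall n, (1 <= n)%N -> 1 <= phi n) ->
  ((fun n => n%:R / phi n) : nat -> R^o) =O_\oo (b : nat -> R^o) ->
  forall eps : R, 0 < eps ->
  exists delta : R, 0 < delta <= 1 /\
    (limn_esup (fun n => tv_distance (lebesgue2 R)
        (tensor_density f0 (n := n))
        (tensor_density (f1 (delta / phi n)%R) (n := n))) <= eps%:E)%E.

End covertness.

(* Main.v *)
Require Import Defs.
From HB Require Import structures.
From mathcomp Require Import all_boot all_order all_algebra.
From mathcomp Require Import all_classical all_reals all_analysis.
From mathcomp Require Import measurable_realfun ring lra.

(** The density [f1 q] is that of every observation, hence of the first one,
    which is an explicit function of five inputs: with [sigma] the service time
    of Willie's first job, [V] its arrival time, [W] Alice's first service time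
    and [A] her first coin, the pair observed is
    [(sigma + max 0 (A W - V), V)] on the almost sure event [0 < V]
    ([first_observationE]).  Conditioning on the coin, the law of this pair is
    the mixture [(1 - q) f0 + q h], where [f0] is the null density and [h]
    the density of the pair when a job is inserted ([first_observation_law],
    [delayed_pair_law]): with [e] the exponential density of rate [lam] and [G2]
    the cdf of [g2],
    [h (y, v) = e v * (int_[0, y] g1 u g2 (v + y - u) du + g1 y * G2 v)].
    Where [g1 y] does not vanish this mixture equals [f0 (1 + q rho)].

    The bound on [n] observations comes from two tensorization arguments.

    If [E rho] is nonzero, [h] puts mass on the set where [g1] vanishes, and a
    single observation there reveals Alice.  The domination [f1 >= (1 - q) f0]
    gives [int |f0 - f1| <= 2 q] ([integral_abs_diff_le]), and replacing the
    factors of the tensor power one at a time gives a total variation of at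
    most [n q = delta n / phi n] ([tv_distance_le_mixture]), which is small
    when [n / phi n] is bounded.

    If [E rho = 0], then [f0 (1 + q rho)] has mass 1.  It lies below [f1], which
    also has mass 1, so the two agree almost everywhere: [h] puts no mass
    where [g1] vanishes.  The chi-squared divergence of one observation is
    therefore [q^2 C0], the one of [n] observations is [(1 + q^2 C0)^n - 1],
    and it controls the total variation ([tv_distance_le_chi2]).  When
    [n / phi n <= K sqrt n], one has
    [n q^2 = delta^2 (n / phi n)^2 / n <= delta^2 K^2], so that a small [delta]
    makes this divergence small uniformly in [n].

    Both tensorizations are inductions on [n] through the iterated integral
    that defines the distance.  They bound each inner integral pointwise by an
    explicit measurable function of the outer variable, and conclude by a
    monotonicity of the integral that holds for a nonmeasurable smaller function
    ([ae_le_integral_nonmeasurable]). *)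

Set Implicit Arguments.
Unset Strict Implicit.
Unset Printing Implicit Defensive.

Import Order.TTheory GRing.Theory Num.Theory.
Import numFieldNormedType.Exports.

Local Open Scope classical_set_scope.
Local Open Scope ring_scope.

(** * Integration against densities *)

Section integration.
Local Open Scope ereal_scope.
Context d (E : measurableType d) (R : realType).
Implicit Types (mu nu : {measure set E -> \bar R}).

Lemma integral_Mindic mu (B : set E) (f : E -> R) : measurable B ->
  \int[mu]_z (f z * \1_B z)%:E = \int[mu]_(z in B) (f z)%:E.
Proof.
move=> mB; rewrite [RHS]integral_mkcond; apply: eq_integral => z _.
by rewrite indicE patchE; case: (_ \in _); rewrite ?mulr1 ?mulr0.
Qed.

Import HBNNSimple.

(** The change of measure is proved on simple functions and passed to the limit
    by monotone convergence on both sides. *)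
Lemma ge0_integral_density mu nu (f : E -> R) (phi : E -> \bar R) :
  measurable_fun [set: E] f -> (forall z, (0 <= f z)%R) ->
  (forall B, measurable B -> mu B = \int[nu]_(z in B) (f z)%:E) ->
  measurable_fun [set: E] phi -> (forall z, 0 <= phi z) ->
  \int[mu]_z phi z = \int[nu]_z (phi z * (f z)%:E).
Proof.
move=> mf f0 muE mphi phi0.
pose p := nnsfun_approx measurableT mphi.
have cvgp z : (fun n => (p n z)%:E) @ \oo --> phi z.
  exact: cvg_nnsfun_approx.
have ndp z : {homo (fun n => (p n z)%:E) : m n / (m <= n)%N >-> m <= n}.
  by move=> m n mn; rewrite lee_fin; exact/lefP/nd_nnsfun_approx.
transitivity (limn (fun n => \int[mu]_z (p n z)%:E)).
  rewrite -monotone_convergence//.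
  - by apply: eq_integral => z _; apply/esym/cvg_lim => //; exact: cvgp.
  - by move=> n; exact/measurable_EFinP.
  - by move=> n z _; rewrite lee_fin.
transitivity (limn (fun n => \int[nu]_z ((p n z)%:E * (f z)%:E))); last first.
  rewrite -monotone_convergence//.
  - apply: eq_integral => z _; apply/cvg_lim => //.
    by apply: cvgeZr => //; exact: cvgp.
  - move=> n; apply: emeasurable_funM; last exact/measurable_EFinP.
    exact/measurable_EFinP.
  - by move=> n z _; rewrite mule_ge0// lee_fin.
  - by move=> z _ m n mn; rewrite lee_wpmul2r ?lee_fin//; have := ndp z _ _ mn.
congr (limn _); apply/funext => n.
transitivity (\sum_(k \in range (p n))
    k%:E * \int[nu]_(z in p n @^-1` [set k]) (f z)%:E).
  by rewrite integralT_nnsfun sintegralE; apply: eq_fsbigr => k _; rewrite muE.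
rewrite [RHS](_ : _ = \int[nu]_z
    \sum_(k \in range (p n)) (k * \1_(p n @^-1` [set k]) z * f z)%:E); last first.
  apply: eq_integral => z _; rewrite -EFinM {1}fimfunE.
  rewrite mulrC fsumEFin//; congr (_%:E).
  rewrite !fsbig_finite//= mulr_sumr.
  by apply: eq_bigr => k _; rewrite mulrC.
have k0 (k : R) z : (0 <= k * \1_(p n @^-1` [set k]) z)%R.
  rewrite indicE; case: (boolP (z \in _)) => [|_]; last by rewrite mulr0.
  by move/set_mem => /= <-; rewrite mulr1.
rewrite ge0_integral_fsum//.
- apply: eq_fsbigr => k /set_mem [x _ kx].
  under [RHS]eq_integral do rewrite -mulrA EFinM.
  rewrite ge0_integralZl//.
  + by under [in RHS]eq_integral do rewrite mulrC; rewrite integral_Mindic.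
  + by apply/measurable_EFinP/measurable_funM.
  + by move=> z _; rewrite lee_fin mulr_ge0.
  + by rewrite lee_fin -kx.
- move=> k; apply/measurable_EFinP/measurable_funM => //.
  exact/measurable_funM.
- by move=> k z _; rewrite lee_fin mulr_ge0.
Qed.

(** The integral of a nonnegative function is a supremum over the simple
    functions below it, hence monotone even for a nonmeasurable [F]; the
    exceptional set is absorbed by letting [G] be infinite there. *)
Lemma ae_le_integral_nonmeasurable mu (F G : E -> \bar R) :
  (forall z, 0 <= F z) -> (forall z, 0 <= G z) ->
  measurable_fun [set: E] G -> {ae mu, forall z, F z <= G z} ->
  \int[mu]_z F z <= \int[mu]_z G z.
Proof.
move=> F0 G0 mG [N [mN muN FGN]].
pose H z := if z \in N then +oo else G z.
have mH : measurable_fun [set: E] H.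
  apply: measurable_fun_ifT => //.
  by apply: (measurable_fun_bool true); rewrite setTI preimage_mem_true.
have H0 z : 0 <= H z by rewrite /H; case: ifP.
have FH z : F z <= H z.
  rewrite /H; case: ifPn => [_|zN]; first exact: leey.
  move/negP: zN; rewrite in_setE; apply: contra_notP => FG.
  exact: FGN.
have -> : \int[mu]_z G z = \int[mu]_z H z.
  apply: ae_eq_integral => //; exists N; split=> //.
  move=> z /= GH; apply: contrapT => Nz; apply: GH => _.
  by rewrite /H memNset.
rewrite !ge0_integralTE//; apply: le_ereal_sup => _ [h hF <-].
by exists h => // z; exact: le_trans (hF z) (FH z).
Qed.

End integration.

(** * Tensor powers of densities *)

Section tensor_powers.
Context (R : realType) d (E : measurableType d) (nu : {measure set E -> \bar R}).
Implicit Types (f : E -> R) (n : nat) (a b c t s L : R).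

Lemma tensor_density_cons f n x (u : n.-tuple E) :
  tensor_density f [tuple of x :: u] = f x * tensor_density f u.
Proof.
rewrite /tensor_density big_ord_recl tnth0; congr (_ * _).
by apply: eq_bigr => i _; rewrite tnthS.
Qed.

Lemma integral_power_ge0 n (F : n.-tuple E -> \bar R) :
  (forall u, 0 <= F u)%E -> (0 <= integral_power nu F)%E.
Proof.
elim: n F => [|n IHn] F F0 /=; first exact: F0.
by apply: integral_ge0 => x _; exact: IHn.
Qed.

Lemma integral_tensor_diff_cons (f0 f1 : E -> R) n a b :
  integral_power nu (fun u : n.+1.-tuple E =>
    `|a * tensor_density f0 u - b * tensor_density f1 u|%:E) =
  (\int[nu]_x integral_power nu (fun u : n.-tuple E =>
    `|a * f0 x * tensor_density f0 u - b * f1 x * tensor_density f1 u|%:E))%E.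
Proof.
apply: eq_integral => x _; congr (integral_power _ _).
by apply/funext => u; rewrite !tensor_density_cons !mulrA.
Qed.

(** Replacing the factors of the tensor power one at a time costs
    [int |f0 - f1|] per factor.  The weights [a] and [b] carry the product of
    the factors already integrated, which makes the induction go through. *)
Lemma integral_tensor_diff_le (f0 f1 : E -> R) t n a b :
  measurable_fun [set: E] f0 -> measurable_fun [set: E] f1 ->
  (forall x, 0 <= f0 x) -> (forall x, 0 <= f1 x) ->
  (\int[nu]_x (f0 x)%:E = 1)%E -> (\int[nu]_x (f1 x)%:E = 1)%E ->
  (\int[nu]_x `|f0 x - f1 x|%:E <= t%:E)%E ->
  0 <= t -> 0 <= b ->
  (integral_power nu (fun u : n.-tuple E =>
    `|a * tensor_density f0 u - b * tensor_density f1 u|%:E) <=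
  (`|a - b| + b * (t *+ n))%:E)%E.
Proof.
move=> mf0 mf1 f0_ge0 f1_ge0 if0 if1 idiff t0.
elim: n a b => [|n IHn] a b b0.
  by rewrite /= /tensor_density !big_ord0 !mulr1 mulr0n mulr0 addr0.
have md : measurable_fun [set: E] (fun x => `|f0 x - f1 x|).
  by apply: measurableT_comp => //; exact: measurable_funB.
have mZ (k : R) (f : E -> R) : measurable_fun [set: E] f ->
    measurable_fun [set: E] (fun x => (k%:E * (f x)%:E)%E).
  by move=> mf; apply/measurable_EFinP/measurable_funM.
rewrite integral_tensor_diff_cons.
apply: (@le_trans _ _ (\int[nu]_x (`|a - b|%:E * (f0 x)%:E +
  (b%:E * `|f0 x - f1 x|%:E + (b * (t *+ n))%:E * (f1 x)%:E)))%E).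
  apply: ae_le_integral_nonmeasurable.
  - by move=> x; apply: integral_power_ge0 => u; rewrite lee_fin.
  - move=> x; rewrite !adde_ge0 ?mule_ge0 ?lee_fin//.
    by rewrite mulr_ge0 ?mulrn_wge0.
  - by apply: emeasurable_funD; [|apply: emeasurable_funD]; exact: mZ.
  - apply: aeW => x; apply: le_trans (IHn _ _ _) _; first by rewrite mulr_ge0.
    rewrite -!EFinM -!EFinD lee_fin addrA lerD//; last by rewrite mulrAC.
    rewrite (_ : a * _ - _ = (a - b) * f0 x + b * (f0 x - f1 x)); last by ring.
    rewrite (le_trans (ler_normD _ _))// !normrM (ger0_norm (f0_ge0 x)).
    by rewrite (ger0_norm b0).
have t_n0 : 0 <= t *+ n by rewrite mulrn_wge0.
rewrite ge0_integralD//; [|by move=> x _; rewrite mule_ge0 ?lee_fin|exact: mZ| |];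
  last 2 first.
  - by move=> x _; rewrite adde_ge0// mule_ge0 ?lee_fin// mulr_ge0.
  - by apply: emeasurable_funD; exact: mZ.
rewrite ge0_integralD//;
  [|by move=> x _; rewrite mule_ge0 ?lee_fin|exact: mZ| |exact: mZ]; last first.
  by move=> x _; rewrite mule_ge0 ?lee_fin// mulr_ge0.
rewrite !ge0_integralZl_EFin//;
  try by [apply/measurable_EFinP|move=> x _; rewrite lee_fin|rewrite mulr_ge0].
rewrite if0 if1 !mule1 EFinD leeD2l// mulrS mulrDr EFinD leeD2r//.
by rewrite EFinM lee_wpmul2l ?lee_fin.
Qed.

(** With [p], [p'] the two tensor powers and [p' = p M], the inequality
    [2 c |1 - L M| <= c^2 + (1 - L M)^2], integrated against [p], bounds the
    left-hand side through the mean 1 and the second moment [s ^+ n] of [M].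
    The induction uses this bound as a function of the likelihood ratio [L]
    accumulated so far; it is nonnegative because [1 <= s]. *)
Lemma integral_tensor_chi2_le (f0 f1 l : E -> R) s c n a L :
  measurable_fun [set: E] f0 -> measurable_fun [set: E] l ->
  (forall x, 0 <= f0 x) ->
  {ae nu, forall x, f1 x = f0 x * l x} ->
  nu.-integrable [set: E] (fun x => (f0 x)%:E) ->
  nu.-integrable [set: E] (fun x => (f0 x * l x)%:E) ->
  nu.-integrable [set: E] (fun x => (f0 x * l x ^+ 2)%:E) ->
  (\int[nu]_x (f0 x)%:E = 1)%E ->
  (\int[nu]_x (f0 x * l x)%:E = 1)%E ->
  (\int[nu]_x (f0 x * l x ^+ 2)%:E = s%:E)%E ->
  1 <= s -> 0 < c -> 0 <= a ->
  (integral_power nu (fun u : n.-tuple E =>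
    `|a * tensor_density f0 u - a * L * tensor_density f1 u|%:E) <=
  (a * ((c ^+ 2 + 1 + L ^+ 2 * s ^+ n - 2 * L) / (2 * c)))%:E)%E.
Proof.
move=> mf0 ml f0_ge0 f1E int0 int1 int2 if0 if1 if2 s1 c0.
elim: n a L => [|n IHn] a L a0.
  rewrite /= /tensor_density !big_ord0 !mulr1 lee_fin -{1}(mulr1 a) -mulrBr.
  rewrite normrM (ger0_norm a0) ler_wpM2l// ler_pdivlMr ?mulr_gt0//.
  rewrite -subr_ge0 (_ : _ - _ = (c - `|1 - L|) ^+ 2); last first.
    by rewrite sqrrB real_normK ?num_real//; ring.
  exact: sqr_ge0.
pose K x := a * f0 x *
  ((c ^+ 2 + 1 + (L * l x) ^+ 2 * s ^+ n - 2 * (L * l x)) / (2 * c)).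
have KE x : (K x)%:E = ((a * (c ^+ 2 + 1) / (2 * c))%:E * (f0 x)%:E +
    ((a * L ^+ 2 * s ^+ n / (2 * c))%:E * (f0 x * l x ^+ 2)%:E +
    (- (a * L / c))%:E * (f0 x * l x)%:E))%E.
  by rewrite -!EFinM -!EFinD /K; congr _%:E; field; rewrite gt_eqF.
have K0 x : 0 <= K x.
  rewrite /K !mulr_ge0// ?invr_ge0 ?mulr_ge0 ?(ltW c0)//.
  set y := L * l x.
  have : y ^+ 2 <= y ^+ 2 * s ^+ n by rewrite ler_peMr ?sqr_ge0// exprn_ege1.
  have := sqr_ge0 (1 - y); have := sqr_ge0 c.
  by rewrite (_ : (1 - y) ^+ 2 = 1 - 2 * y + y ^+ 2); [lra|ring].
rewrite integral_tensor_diff_cons.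
apply: (@le_trans _ _ (\int[nu]_x (K x)%:E)%E).
  apply: ae_le_integral_nonmeasurable.
  - by move=> x; apply: integral_power_ge0 => u; rewrite lee_fin.
  - by move=> x; rewrite lee_fin.
  - apply/measurable_EFinP/measurable_funM; first exact: measurable_funM.
    apply: measurable_funM => //; apply: measurable_funB.
      apply: measurable_funD => //; apply: measurable_funM => //.
      by apply: measurable_funX; exact: measurable_funM.
    by apply: measurable_funM => //; exact: measurable_funM.
  - apply: filterS f1E => x f1x.
    rewrite (_ : a * L * f1 x = a * f0 x * (L * l x)); last by rewrite f1x; ring.
    by apply: IHn; rewrite mulr_ge0.
under eq_integral do rewrite KE.
rewrite integralD//; [|exact: integrableZl|];
  last by apply: integrableD => //; exact: integrableZl.
rewrite integralD//; [|exact: integrableZl|exact: integrableZl].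
rewrite !integralZl// if0 if1 if2 !mule1 -!EFinM -!EFinD lee_fin.
rewrite le_eqVlt; apply/orP; left; apply/eqP.
by rewrite (exprS s n); field; rewrite gt_eqF.
Qed.

End tensor_powers.

(** * Comparison of two densities *)

Section densities.
Local Open Scope ereal_scope.
Context (R : realType) d (E : measurableType d) (nu : {measure set E -> \bar R}).
Implicit Types (f k : E -> R) (q t s : R).

(** Both densities have mass 1, so [int |f0 - f1|] is twice the integral of
    [f0 - f1] over the set [B] where it is positive, and the domination bounds
    this integral by [q int_B f0]. *)
Lemma integral_abs_diff_le (f0 f1 : E -> R) q :
  measurable_fun [set: E] f0 -> measurable_fun [set: E] f1 ->
  (forall x, 0 <= f0 x)%R -> (forall x, 0 <= f1 x)%R ->
  \int[nu]_x (f0 x)%:E = 1 -> \int[nu]_x (f1 x)%:E = 1 ->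
  (0 <= q <= 1)%R ->
  (forall B, measurable B ->
    (1 - q)%:E * \int[nu]_(x in B) (f0 x)%:E <= \int[nu]_(x in B) (f1 x)%:E) ->
  \int[nu]_x `|f0 x - f1 x|%:E <= (2 * q)%:E.
Proof.
move=> mf0 mf1 f0_ge0 f1_ge0 if0 if1 /andP[q0 q1] f0f1.
pose B := [set x | f1 x < f0 x]%R.
have mB : measurable B.
  rewrite -[B]setTI (_ : B = (fun x => f1 x < f0 x)%R @^-1` [set true]).
    exact: measurable_fun_ltr.
  by rewrite preimage_true.
have intB f : measurable_fun [set: E] f -> (forall x, 0 <= f x)%R ->
    \int[nu]_x (f x)%:E = 1 -> \int[nu]_(x in B) (f x)%:E \is a fin_num.
  move=> mf f_ge0 if1'; rewrite ge0_fin_numE; last first.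
    by apply: integral_ge0 => x _; rewrite lee_fin.
  rewrite (@le_lt_trans _ _ 1) ?ltry// -if1' ge0_subset_integral//.
  - exact/measurable_EFinP.
  - by move=> x _; rewrite lee_fin.
have le1B : \int[nu]_(x in B) (f0 x)%:E <= 1.
  rewrite -if0 ge0_subset_integral//.
  - exact/measurable_EFinP.
  - by move=> x _; rewrite lee_fin.
have fin0 := intB _ mf0 f0_ge0 if0; have fin1 := intB _ mf1 f1_ge0 if1.
have md : measurable_fun [set: E] (fun x => `|f0 x - f1 x|%R).
  by apply: measurableT_comp => //; exact: measurable_funB.
have intd : \int[nu]_x `|f0 x - f1 x|%:E + \int[nu]_x (f0 x)%:E +
      2%:E * \int[nu]_(x in B) (f1 x)%:E =
    \int[nu]_x (f1 x)%:E + 2%:E * \int[nu]_(x in B) (f0 x)%:E.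
  have m2 f : measurable_fun [set: E] f ->
      measurable_fun [set: E] (fun x => (2 * (f x * \1_B x))%R).
    by move=> mf; apply: measurable_funM => //; exact: measurable_funM.
  have i2 f : measurable_fun [set: E] f -> (forall x, 0 <= f x)%R ->
      2%:E * \int[nu]_(x in B) (f x)%:E = \int[nu]_x (2 * (f x * \1_B x))%:E.
    move=> mf f_ge0; rewrite -integral_Mindic// -ge0_integralZl_EFin//.
    - by move=> x _; rewrite lee_fin mulr_ge0.
    - by apply/measurable_EFinP; exact: measurable_funM.
  have iD (f g : E -> R) : measurable_fun [set: E] f -> (forall x, 0 <= f x)%R ->
      measurable_fun [set: E] g -> (forall x, 0 <= g x)%R ->
      \int[nu]_x (f x)%:E + \int[nu]_x (g x)%:E = \int[nu]_x (f x + g x)%:E.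
    move=> mf f_ge0 mg g_ge0; rewrite -ge0_integralD//.
    - by move=> x _; rewrite lee_fin.
    - exact/measurable_EFinP.
    - by move=> x _; rewrite lee_fin.
    - exact/measurable_EFinP.
  rewrite !i2// (iD _ _ md)// !iD//.
  - apply: eq_integral => x _; rewrite indicE; congr _%:E.
    case: (boolP (x \in B)) => [|/negP xB].
      by rewrite inE /B/= => xB; rewrite gtr0_norm ?subr_gt0//; ring.
    have : (f0 x <= f1 x)%R.
      by rewrite leNgt; apply/negP => ?; apply: xB; rewrite inE.
    by move=> ?; rewrite ler0_norm ?subr_le0// mulr0n !mulr0 !addr0 opprB subrK.
  - exact: m2.
  - by move=> x; rewrite !mulr_ge0.
  - exact: measurable_funD.
  - by move=> x; rewrite addr_ge0.
  - exact: m2.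
  - by move=> x; rewrite !mulr_ge0.
have := f0f1 _ mB; move: intd le1B; rewrite if0 if1.
rewrite -(fineK fin0) -(fineK fin1).
set i1 := fine _; set i0 := fine _.
have : 0 <= \int[nu]_x `|f0 x - f1 x|%:E.
  by apply: integral_ge0 => x _; rewrite lee_fin.
case: (\int[nu]_x `|f0 x - f1 x|%:E) => [z||]//= z0 [zE].
rewrite -?EFinM !lee_fin => i01 i0i1.
suff : ((1 - q) * i0 = i0 - q * i0)%R /\ (q * i0 <= q)%R.
  by move=> [e le]; move: i0i1; rewrite e; lra.
by split; [ring|rewrite ler_piMr].
Qed.

(** The complement of [B] gives the reverse of the inequality on [B]. *)
Lemma ae_eq_of_le_integral (f k : E -> R) :
  measurable_fun [set: E] f -> measurable_fun [set: E] k ->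
  (forall x, 0 <= f x)%R -> (forall x, 0 <= k x)%R ->
  \int[nu]_x (f x)%:E = 1 -> \int[nu]_x (k x)%:E = 1 ->
  (forall B, measurable B ->
    \int[nu]_(x in B) (k x)%:E <= \int[nu]_(x in B) (f x)%:E) ->
  {ae nu, forall x, f x = k x}.
Proof.
move=> mf mk f0 k0 if1 ik1 kf.
have splitB (g : E -> R) : measurable_fun [set: E] g -> (forall x, 0 <= g x)%R ->
    \int[nu]_x (g x)%:E = 1 -> forall B, measurable B ->
    \int[nu]_(x in B) (g x)%:E + \int[nu]_(x in ~` B) (g x)%:E = 1.
  move=> mg g0 ig B mB; rewrite -ge0_integral_setU//.
  - by rewrite setUv.
  - exact: measurableC.
  - by rewrite setUv; exact/measurable_EFinP.
  - by move=> x _; rewrite lee_fin.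
  - exact/disj_setPCl.
have ge0 (g : E -> R) B : (forall x, 0 <= g x)%R -> 0 <= \int[nu]_(x in B) (g x)%:E.
  by move=> g0; apply: integral_ge0 => x _; rewrite lee_fin.
have fkB B : measurable B ->
    \int[nu]_(x in B) (f x)%:E = \int[nu]_(x in B) (k x)%:E.
  move=> mB; move: (splitB _ mf f0 if1 _ mB) (splitB _ mk k0 ik1 _ mB).
  move: (kf _ mB) (kf _ (measurableC mB)).
  move: (ge0 _ B f0) (ge0 _ (~` B) f0) (ge0 _ B k0) (ge0 _ (~` B) k0).
  case: (\int[nu]_(x in B) (f x)%:E) => [a||]//;
    case: (\int[nu]_(x in ~` B) (f x)%:E) => [b||]//;
    case: (\int[nu]_(x in B) (k x)%:E) => [c||]//;
    case: (\int[nu]_(x in ~` B) (k x)%:E) => [e||]//.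
  rewrite !lee_fin => _ _ _ _ ca eb [ab] [ce]; congr _%:E; lra.
have : ae_eq nu [set: E] (EFin \o f) (EFin \o k).
  apply: integral_ae_eq => //.
  - apply/integrableP; split; first exact/measurable_EFinP.
    by under eq_integral do rewrite /= ger0_norm//; rewrite if1 ltry.
  - exact/measurable_EFinP.
  - by move=> B _ mB; exact: fkB.
by apply: filterS => x /(_ Logic.I) [].
Qed.

End densities.

(** * From total variation bounds to covertness *)

Section asymptotics.
Context (R : realType).
Implicit Types (q c C : R) (n : nat).

Lemma limn_esup_le_near (u : (\bar R)^nat) (l : \bar R) :
  (\forall n \near \oo, (u n <= l)%E) -> (limn_esup u <= l)%E.
Proof.
move=> ul; rewrite /limn_esup /limf_esup.
apply: (@le_trans _ _ (ereal_sup (u @` [set n | (u n <= l)%E]))).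
  by apply: ereal_inf_lbound; exists [set n | (u n <= l)%E].
by apply: ge_ereal_sup => _ [n /= unl <-].
Qed.

Lemma covertly_inserts_bigO1 (f0 : R * R -> R) (f1 : R -> R * R -> R) :
  (forall q n, 0 <= q <= 1 ->
    (tv_distance (lebesgue2 R) (tensor_density f0 (n := n))
      (tensor_density (f1 q) (n := n)) <= (n%:R * q)%:E)%E) ->
  covertly_inserts_bigO f0 f1 (fun=> 1).
Proof.
move=> tv phi phi1 /eqO_exP [K K0 phiO] eps eps0.
(* [delta <= eps / K] gives [n q <= K delta <= eps]. *)
have d0 : 0 < Num.min 1 (eps / K) by rewrite lt_min ltr01 divr_gt0.
exists (Num.min 1 (eps / K)); split; first by rewrite d0 ge_min lexx.
set delta := Num.min _ _ in d0 *.
apply: limn_esup_le_near; near=> n.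
have n1 : (1 <= n)%N by near: n; exists 1%N.
have phin := phi1 _ n1.
have phi0 : 0 < phi n by apply: lt_le_trans phin.
have : `|n%:R / phi n : R^o| <= K * `|1 : R^o|.
  by near: n; exact: phiO.
rewrite normr1 mulr1 ger0_norm ?divr_ge0 ?(ltW phi0)// => nK.
apply: le_trans (tv _ _ _) _.
  rewrite divr_ge0 ?(ltW d0) ?(ltW phi0)//= ler_pdivrMr// mul1r.
  by rewrite (le_trans _ phin)// ge_min lexx.
rewrite lee_fin mulrA mulrAC mulrC.
apply: (@le_trans _ _ (eps / K * K)); last by rewrite divfK// gt_eqF.
by rewrite ler_pM// ?(ltW d0)// ?divr_ge0 ?(ltW phi0)// ge_min lexx orbT.
Unshelve. all: by end_near. Qed.

Lemma covertly_inserts_bigO_sqrt C (f0 : R * R -> R) (f1 : R -> R * R -> R) :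
  0 <= C ->
  (forall q n c, 0 <= q <= 1 -> 0 < c ->
    (tv_distance (lebesgue2 R) (tensor_density f0 (n := n))
      (tensor_density (f1 q) (n := n)) <=
     ((c + ((1 + q ^+ 2 * C) ^+ n - 1) / c) / 4)%:E)%E) ->
  covertly_inserts_bigO f0 f1 (fun n => Num.sqrt n%:R).
Proof.
move=> C0 tv phi phi1 /eqO_exP [K K0 phiO] eps eps0.
(* [delta] is such that [delta^2 K^2 C <= ln (1 + eps^2)], hence
   [(1 + q^2 C)^n <= exp (n q^2 C) <= 1 + eps^2]; the bound is then used with
   [c = eps].  The summand 1 in [A] keeps it nonzero. *)
pose A := 1 + K ^+ 2 * C.
have A0 : 0 < A by rewrite ltr_wpDr// mulr_ge0// sqr_ge0.
have L0 : 0 < ln (1 + eps ^+ 2) by rewrite ln_gt0// ltrDl exprn_gt0.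
pose r := Num.sqrt (ln (1 + eps ^+ 2) / A).
have r0 : 0 < r by rewrite sqrtr_gt0 divr_gt0.
have d0 : 0 < Num.min 1 r by rewrite lt_min ltr01.
exists (Num.min 1 r); split; first by rewrite d0 ge_min lexx.
set delta := Num.min _ _ in d0 *.
have dA : delta ^+ 2 * (K ^+ 2 * C) <= ln (1 + eps ^+ 2).
  apply: (@le_trans _ _ (r ^+ 2 * A)).
    apply: ler_pM; rewrite ?sqr_ge0 ?mulr_ge0 ?sqr_ge0 ?(ltW K0)//;
      last by rewrite /A lerDr.
    have dr : delta <= r by rewrite ge_min lexx orbT.
    by apply: lerXn2r => //; rewrite nnegrE ltW.
  rewrite sqr_sqrtr; last by rewrite divr_ge0 ?ltW.
  by rewrite divfK// gt_eqF.
apply: limn_esup_le_near; near=> n.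
have n1 : (1 <= n)%N by near: n; exists 1%N.
have n0 : 0 < n%:R :> R by rewrite ltr0n.
have phin := phi1 _ n1.
have phi0 : 0 < phi n by apply: lt_le_trans phin.
have : `|n%:R / phi n : R^o| <= K * `|Num.sqrt n%:R : R^o|.
  by near: n; exact: phiO.
rewrite !ger0_norm ?divr_ge0 ?sqrtr_ge0 ?(ltW phi0)// => nK.
set q := delta / phi n.
have nq : n%:R * q ^+ 2 <= delta ^+ 2 * K ^+ 2.
  rewrite -(ler_pM2l n0).
  rewrite (_ : _ * (_ * q ^+ 2) = delta ^+ 2 * (n%:R / phi n) ^+ 2); last first.
    by rewrite /q; field; rewrite gt_eqF.
  have -> : n%:R * (delta ^+ 2 * K ^+ 2) = delta ^+ 2 * (K * Num.sqrt n%:R) ^+ 2.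
    by rewrite exprMn sqr_sqrtr ?(ltW n0)//; ring.
  rewrite ler_wpM2l ?sqr_ge0// lerXn2r ?nnegrE//.
    by rewrite divr_ge0 ?ltW.
  by rewrite mulr_ge0 ?sqrtr_ge0 ?ltW.
apply: le_trans (tv _ _ eps _ eps0) _.
  rewrite /q divr_ge0 ?(ltW d0) ?(ltW phi0)//= ler_pdivrMr// mul1r.
  by rewrite (le_trans _ phin)// ge_min lexx.
rewrite lee_fin.
have qC0 : 0 <= q ^+ 2 * C by rewrite mulr_ge0// sqr_ge0.
have : (1 + q ^+ 2 * C) ^+ n <= 1 + eps ^+ 2.
  apply: (@le_trans _ _ (expR (q ^+ 2 * C) ^+ n)).
    rewrite lerXn2r ?nnegrE ?expR_ge0 ?expR_ge1Dx//; lra.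
  rewrite -expRM_natl -[leRHS]lnK ?posrE; last by rewrite ltr_pwDl// sqr_ge0.
  rewrite ler_expR (le_trans _ dA)// [leRHS]mulrA mulrA.
  by rewrite ler_wpM2r.
move=> le_eps.
have : ((1 + q ^+ 2 * C) ^+ n - 1) / eps <= eps.
  by rewrite ler_pdivrMr// -expr2 lerBlDl.
by move=> ?; lra.
Unshelve. all: by end_near. Qed.

End asymptotics.

(** * The law of the first observation *)

Section restricted_law.
Local Open Scope ereal_scope.
Context d (T : measurableType d) (R : realType) (P : probability T R).
Context d1 (E : measurableType d1) (X : T -> E) (Ev : set T).
Hypotheses (mX : measurable_fun [set: T] X) (mEv : measurable Ev).

(** The law of [X] under the restriction of [P] to the event [Ev]; the proofs
    are arguments so that the measure structure can be attached to it. *)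
Definition restricted_law of measurable_fun [set: T] X & measurable Ev :
  set E -> \bar R := fun A => P (X @^-1` A `&` Ev).

Local Notation law := (restricted_law mX mEv).

Let mpre A : measurable A -> measurable (X @^-1` A `&` Ev).
Proof.
move=> mA; apply: measurableI => //.
by rewrite -[X in measurable X]setTI; exact: mX.
Qed.

Let law0 : law set0 = 0.
Proof. by rewrite /restricted_law preimage_set0 set0I measure0. Qed.

Let law_ge0 A : 0 <= law A. Proof. exact: measure_ge0. Qed.

Let law_sigma_additive : semi_sigma_additive law.
Proof.
move=> F mF tF mUF; rewrite /restricted_law preimage_bigcup setI_bigcupl.
apply: measure_semi_sigma_additive.
- by move=> n; exact: mpre.
- apply/trivIsetP => /= i j _ _ ij; rewrite setIACA -preimage_setI.
  by move/trivIsetP : tF => /(_ _ _ _ _ ij) ->//; rewrite preimage_set0 set0I.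
- by rewrite -setI_bigcupl -preimage_bigcup; exact: mpre.
Qed.

HB.instance Definition _ := isMeasure.Build _ _ _ law
  law0 law_ge0 law_sigma_additive.

Let law_fin : fin_num_fun law.
Proof. by move=> A mA; apply: fin_num_measure; exact: mpre. Qed.

HB.instance Definition _ := @Measure_isFinite.Build _ _ _ law law_fin.

End restricted_law.

Lemma ge0_integral_law d (T : measurableType d) (R : realType)
    (P : probability T R) d1 (E : measurableType d1) (X : T -> E)
    (mX : measurable_fun [set: T] X) (phi : E -> \bar R) :
  measurable_fun [set: E] phi -> (forall x, (0 <= phi x)%E) ->
  (\int[restricted_law P mX measurableT]_x phi x = \int[P]_w phi (X w))%E.
Proof.
move=> mphi phi0; rewrite -(ge0_integral_pushforward mX P measurableT)//.
by apply: eq_measure_integral => A mA _; rewrite /= /restricted_law setIT.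
Qed.

Section independence.
Local Open Scope ereal_scope.

(** Independence is required only on rectangles; uniqueness of the product
    measure extends it to all measurable sets.  The event [Ev] is carried along
    because the coin and Alice's service time enter as conditions. *)
Lemma independent_pair_law d (T : measurableType d) (R : realType)
    (P : probability T R) d1 d2 (E1 : measurableType d1) (E2 : measurableType d2)
    (X : T -> E1) (Y : T -> E2) (Ev : set T) :
  measurable_fun [set: T] X -> measurable_fun [set: T] Y -> measurable Ev ->
  (forall A B, measurable A -> measurable B ->
    P (X @^-1` A `&` (Y @^-1` B `&` Ev)) = P (X @^-1` A) * P (Y @^-1` B `&` Ev)) ->
  forall S, measurable S ->
  P ((fun w => (X w, Y w)) @^-1` S `&` Ev) =
  \int[P]_w P (Y @^-1` xsection S (X w) `&` Ev).
Proof.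
move=> mX mY mEv XY S mS.
have mXY : measurable_fun [set: T] (fun w => (X w, Y w)).
  exact: measurable_fun_pair.
pose m1 := restricted_law P mX measurableT.
pose m2 := restricted_law P mY mEv.
have rect A B : measurable A -> measurable B ->
    restricted_law P mXY mEv (A `*` B) = m1 A * m2 B.
  move=> mA mB; rewrite /m1 /m2 /restricted_law setIT -XY//.
  by congr (P _); rewrite setIA.
transitivity ((m1 \x m2) S); first by rewrite (product_measure_unique rect mS).
rewrite /product_measure1 (ge0_integral_law P mX)//.
exact: measurable_fun_xsection.
Qed.

End independence.

Section density_change_of_variables.
Local Open Scope ereal_scope.
Context d (T : measurableType d) (R : realType) (P : probability T R).
Context d' (E : measurableType d') (nu : {measure set E -> \bar R}).

Lemma ge0_integral_has_density (Z : T -> E) (f : E -> R) (phi : E -> \bar R) :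
  measurable_fun [set: T] Z -> has_density P nu Z f ->
  measurable_fun [set: E] phi -> (forall z, 0 <= phi z) ->
  \int[P]_w phi (Z w) = \int[nu]_z (phi z * (f z)%:E).
Proof.
move=> mZ [mf f0 PZ] mphi phi0.
rewrite -(ge0_integral_law P mZ)//.
apply: ge0_integral_density => // B mB.
by rewrite /= /restricted_law setIT PZ.
Qed.

(** The positive and negative parts correspond separately, whether or not they
    are integrable. *)
Lemma integral_has_density (Z : T -> E) (f phi : E -> R) :
  measurable_fun [set: T] Z -> has_density P nu Z f ->
  measurable_fun [set: E] phi ->
  \int[P]_w (phi (Z w))%:E = \int[nu]_z (phi z * f z)%:E.
Proof.
move=> mZ Zf mphi; have [_ f0 _] := Zf.
rewrite [LHS]integralE [RHS]integralE.
have part (psi : E -> R) : measurable_fun [set: E] psi ->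
    \int[P]_w (Num.max (psi (Z w)) 0)%:E =
    \int[nu]_z (Num.max (psi z * f z) 0)%:E.
  move=> mpsi.
  rewrite (ge0_integral_has_density mZ Zf (phi := fun z => (Num.max (psi z) 0)%:E)).
  - by apply: eq_integral => z _; rewrite -EFinM maxr_pMl// mul0r.
  - by apply/measurable_EFinP; exact: measurable_maxr.
  - by move=> z; rewrite lee_fin le_max lexx orbT.
congr (_ - _).
  transitivity (\int[P]_w (Num.max (phi (Z w)) 0)%:E).
    by apply: eq_integral => w _; rewrite funeposE EFin_max.
  by rewrite part//; apply: eq_integral => z _; rewrite funeposE EFin_max.
transitivity (\int[P]_w (Num.max (- phi (Z w)) 0)%:E).
  by apply: eq_integral => w _; rewrite funenegE EFin_max.
rewrite (part (fun z => - phi z)%R); last exact: measurableT_comp.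
by apply: eq_integral => z _; rewrite funenegE EFin_max mulNr.
Qed.

Lemma has_density_mass (Z : T -> E) (f : E -> R) :
  has_density P nu Z f -> \int[nu]_z (f z)%:E = 1.
Proof.
by move=> [_ _ /(_ _ measurableT) <-]; rewrite preimage_setT probability_setT.
Qed.

End density_change_of_variables.

Section delayed_event.
Local Open Scope ereal_scope.
Context (R : realType).

Lemma measurable_integral_xsection d (E : measurableType d) (g : R -> R)
    (S : set (E * measurableTypeR R)) :
  measurable_fun [set: R] g -> (forall x, 0 <= g x)%R -> measurable S ->
  measurable_fun [set: E]
    (fun z => \int[lebesgue_measure]_(w in xsection S z) (g w)%:E).
Proof.
move=> mg g0 mS.
rewrite (_ : (fun z => _) =
    fun z => \int[lebesgue_measure]_w (g w * \1_S (z, w))%:E).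
  apply: (@measurable_fun_fubini_tonelli_F _ _ _ _ _ lebesgue_measure
    (fun x : E * measurableTypeR R => (g x.2 * \1_S x)%:E)) => //.
    apply/measurable_EFinP; apply: measurable_funM => //.
    exact: measurableT_comp.
  by move=> x; rewrite lee_fin mulr_ge0.
apply/funext => z; rewrite -integral_Mindic; last exact: measurable_xsection.
by apply: eq_integral => w _; rewrite !indicE mem_xsection.
Qed.

(** The triples (service time, idle period, Alice's service time) for which the
    pair observed when Alice inserts a job lies in [B]. *)
Definition delayed_event (B : set (measurableTypeR R * measurableTypeR R)) :
    set ((measurableTypeR R * measurableTypeR R) * measurableTypeR R) :=
  [set x | B (x.1.1 + Num.max 0 (x.2 - x.1.2), x.1.2)%R].

Lemma measurable_delayed_event B : measurable B -> measurable (delayed_event B).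
Proof.
move=> mB; rewrite -[delayed_event B]setTI.
apply: (_ : measurable_fun _ (fun x : (R * R) * R =>
  (x.1.1 + Num.max 0 (x.2 - x.1.2), x.1.2)%R)) => //.
apply: measurable_fun_pair.
  apply: measurable_funD; first exact: measurableT_comp.
  apply: measurable_maxr => //; apply: measurable_funB => //.
  exact: measurableT_comp.
exact: measurableT_comp.
Qed.

End delayed_event.

Section queue.
Local Open Scope ereal_scope.
Context d (T : measurableType d) (R : realType) (U : queue_inputs T R).

(** The maximum in the recursion becomes [Num.max 0 _] once the arrival time is
    subtracted. *)
Lemma first_observationE w : observation U 1 w =
  (wservice U 1 w + Num.max 0 ((if (0 < gap U 1 w)%R && coin U 1 w
     then aservice U 1 w else 0) - gap U 1 w), gap U 1 w)%R.
Proof.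
rewrite /observation /first_service /idle_period /= /reconstructed /departure /=.
rewrite /arrival /index_iota /= !big_seq1 subr0; congr pair.
rewrite add0r [(_ + wservice _ _ _)%R]addrC -addrA; congr (_ + _)%R.
by rewrite addr_maxl subrr.
Qed.


Section IEBP.
Context (P : probability T R) (lam : R) (g1 g2 : R -> R) (q : R).
Hypothesis lam_gt0 : (0 < lam)%R.
Hypothesis law : IEBP_law U P lam g1 g2 q.

Local Notation sigma := (wservice U 1).
Local Notation V := (gap U 1).
Local Notation W := (aservice U 1).
Local Notation A := (fun w => (coin U 1 w)%:R : R).
Local Notation f0 := (null_density g1 lam).

Lemma independent_first_inputs (B1 B2 B3 B4 : set R) :
  measurable B1 -> measurable B2 -> measurable B3 -> measurable B4 ->
  P (sigma @^-1` B1 `&` (V @^-1` B2 `&` (W @^-1` B3 `&` A @^-1` B4))) =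
  P (sigma @^-1` B1) * (P (V @^-1` B2) * (P (W @^-1` B3) * P (A @^-1` B4))).
Proof.
move=> mB1 mB2 mB3 mB4.
pose B (k : (nat + nat) + (nat + nat)) := match k with
  | inl (inl _) => B2 | inl (inr _) => B1
  | inr (inl _) => B3 | inr (inr _) => B4 end.
pose s : seq ((nat + nat) + (nat + nat)) :=
  [:: inl (inr 1%N); inl (inl 1%N); inr (inl 1%N); inr (inr 1%N)].
have mB i : measurable (B i) by case: i => [[]|[]].
have := inputs_independent law (s := s) isT (B := B) mB.
rewrite !big_cons big_nil mule1 /= => <-; congr (P _).
apply/seteqP; split => w /=.
  by move=> [? [? [? ?]]] i /=; rewrite !inE => /or4P[] /eqP ->.
move=> h; split; [|split; [|split]].
- by apply: (h (inl (inr 1%N))); rewrite /= !inE eqxx.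
- by apply: (h (inl (inl 1%N))); rewrite /= !inE eqxx ?orbT.
- by apply: (h (inr (inl 1%N))); rewrite /= !inE eqxx ?orbT.
- by apply: (h (inr (inr 1%N))); rewrite /= !inE eqxx ?orbT.
Qed.

Let sigma_law : has_density P lebesgue_measure sigma g1.
Proof. exact: (wservice_law law). Qed.

Let V_law : has_density P lebesgue_measure V (exponential_pdf lam).
Proof. exact: (gap_law law). Qed.

Let W_law : has_density P lebesgue_measure W g2.
Proof. exact: (aservice_law law). Qed.

Let mg1 : measurable_fun [set: R] g1. Proof. by case: sigma_law. Qed.
Let g1_ge0 x : (0 <= g1 x)%R. Proof. by case: sigma_law. Qed.
Let mg2 : measurable_fun [set: R] g2. Proof. by case: W_law. Qed.
Let g2_ge0 x : (0 <= g2 x)%R. Proof. by case: W_law. Qed.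

Let pre (X : {mfun T >-> R}) B : measurable B -> measurable (X @^-1` B).
Proof. by move=> mB; rewrite -[X in measurable X]setTI; exact: measurable_funP. Qed.

Let mfunP (X : {mfun T >-> R}) : measurable_fun [set: T] X.
Proof. exact: measurable_funP. Qed.

Let mA : measurable_fun [set: T] A.
Proof.
have mb : measurable_fun [set: bool] (fun b => b%:R : R) by [].
exact: (measurableT_comp mb).
Qed.

Let preA B : measurable B -> measurable (A @^-1` B).
Proof. by move=> mB; rewrite -[X in measurable X]setTI; exact: mA. Qed.

Let mf0 : measurable_fun [set: measurableTypeR R * measurableTypeR R] f0.
Proof.
apply: measurable_funM; first exact: measurableT_comp.
by apply: measurableT_comp => //; exact: measurable_exponential_pdf.
Qed.

(** The events on Alice's service time and on the coin factor out by
    independence, and the sections in [V] integrate to [null_density]. *)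
Lemma first_pair_law (B3 B4 : set R)
    (S : set (measurableTypeR R * measurableTypeR R)) :
  measurable B3 -> measurable B4 -> measurable S ->
  P ((fun w => (sigma w, V w)) @^-1` S `&` (W @^-1` B3 `&` A @^-1` B4)) =
  P (W @^-1` B3) * P (A @^-1` B4) * \int[lebesgue2 R]_(z in S) (f0 z)%:E.
Proof.
move=> mB3 mB4 mS; set p := P _ * P _.
have mEv : measurable (W @^-1` B3 `&` A @^-1` B4).
  by apply: measurableI; [exact: pre|exact: preA].
have p0 : 0 <= p by rewrite mule_ge0.
have PV B2 : measurable B2 ->
    P (V @^-1` B2 `&` (W @^-1` B3 `&` A @^-1` B4)) = P (V @^-1` B2) * p.
  move=> mB2; have := independent_first_inputs measurableT mB2 mB3 mB4.
  by rewrite preimage_setT setTI probability_setT mul1e.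
rewrite independent_pair_law//; last first.
  by move=> B1 B2 mB1 mB2; rewrite PV// independent_first_inputs.
have e0 x : (0 <= exponential_pdf lam x)%R by rewrite exponential_pdf_ge0// ltW.
have me : measurable_fun [set: R] (exponential_pdf lam).
  exact: measurable_exponential_pdf.
pose phi u := \int[lebesgue_measure]_v
  (exponential_pdf lam v * \1_S (u, v))%:E.
have mS1 : measurable_fun [set: measurableTypeR R * measurableTypeR R]
    (fun z => (exponential_pdf lam z.2 * \1_S z)%:E).
  by apply/measurable_EFinP; apply: measurable_funM => //; exact: measurableT_comp.
have mphi : measurable_fun [set: R] phi.
  apply: (@measurable_fun_fubini_tonelli_F _ _ _ _ _ lebesgue_measure
    (fun z => (exponential_pdf lam z.2 * \1_S z)%:E)) => //.
  by move=> z; rewrite lee_fin mulr_ge0.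
have phi0 u : 0 <= phi u by apply: integral_ge0 => v _; rewrite lee_fin mulr_ge0.
have PE u : P (V @^-1` xsection S u `&` (W @^-1` B3 `&` A @^-1` B4)) = p * phi u.
  have mSu : measurable (xsection S u) by exact: measurable_xsection.
  rewrite PV//.
  rewrite muleC; congr (_ * _); have [_ _ ->//] := V_law.
  rewrite -integral_Mindic//; apply: eq_integral => v _.
  by rewrite !indicE mem_xsection.
under eq_integral do rewrite PE.
rewrite ge0_integralZl//; last first.
  by apply: measurableT_comp => //; exact: measurable_funP.
congr (_ * _).
rewrite (ge0_integral_has_density _ sigma_law)//; last exact: mfunP.
rewrite -integral_Mindic//.
have mfS : measurable_fun [set: measurableTypeR R * measurableTypeR R]
    (fun z => (f0 z * \1_S z)%:E).
  by apply/measurable_EFinP; apply: measurable_funM.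
rewrite /lebesgue2 fubini_tonelli1//; last first.
  by move=> z; rewrite lee_fin !mulr_ge0.
apply: eq_integral => u _; rewrite /phi /fubini_F -ge0_integralZr//.
- by apply: eq_integral => v _; rewrite -EFinM /null_density; congr _%:E; ring.
- exact: (measurable_fun_pair2 u mS1).
- by move=> v _; rewrite lee_fin mulr_ge0.
- by rewrite lee_fin.
Qed.

Let f0_ge0 z : (0 <= f0 z)%R.
Proof. by rewrite mulr_ge0// exponential_pdf_ge0// ltW. Qed.

Lemma first_pair_has_density :
  has_density P (lebesgue2 R) (fun w => (sigma w, V w)) f0.
Proof.
split => // S mS; have := first_pair_law measurableT measurableT mS.
by rewrite !preimage_setT setIT setIT !probability_setT !mul1e.
Qed.

Lemma first_coin_true : P (A @^-1` [set 1%R]) = q%:E.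
Proof.
rewrite -(coin_law law (leqnn 1)); congr (P _).
apply/seteqP; split => w /=; case: (coin U 1 w) => //= /eqP.
by rewrite eq_sym oner_eq0.
Qed.

Lemma first_coin_false : P (A @^-1` [set 0%R]) = (1 - q)%:E.
Proof.
rewrite -(_ : ~` (A @^-1` [set 1%R]) = A @^-1` [set 0%R]).
  by rewrite probability_setC ?first_coin_true//; exact: preA.
apply/seteqP; split => w /=; case: (coin U 1 w) => //=.
- by move=> /eqP; rewrite oner_eq0.
- by move=> _ /eqP; rewrite eq_sym oner_eq0.
Qed.

Lemma first_gap_le0 : P (V @^-1` `]-oo, 0%R]) = 0.
Proof.
have [_ _ ->//] := V_law.
rewrite -integral_itv_bndo_bndc; last first.
  by apply/measurable_funTS/measurable_EFinP; exact: measurable_exponential_pdf.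
apply: integral0_eq => x; rewrite /= in_itv/= => x0.
by rewrite lt0_exponential_pdf.
Qed.

Lemma first_triple_law
    (S : set ((measurableTypeR R * measurableTypeR R) * measurableTypeR R)) :
  measurable S ->
  P ((fun w => ((sigma w, V w), W w)) @^-1` S `&` A @^-1` [set 1%R]) =
  q%:E * \int[lebesgue2 R]_z
    (\int[lebesgue_measure]_(w in xsection S z) (g2 w)%:E * (f0 z)%:E).
Proof.
move=> mS.
have [m1 m0] : measurable [set 1%R : R] /\ measurable [set 0%R : R] by [].
have mX : measurable_fun [set: T]
    (fun w => (sigma w, V w) : measurableTypeR R * measurableTypeR R).
  exact: measurable_fun_pair (mfunP sigma) (mfunP V).
have PW B : measurable B ->
    P (W @^-1` B `&` A @^-1` [set 1%R]) = P (W @^-1` B) * P (A @^-1` [set 1%R]).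
  move=> mB; have := independent_first_inputs measurableT measurableT mB m1.
  by rewrite !preimage_setT !setTI probability_setT !mul1e.
rewrite (independent_pair_law mX)//; last 2 first.
- exact: preA.
- move=> S' B mS' mB; have [_ _ ->//] := first_pair_has_density.
  by rewrite first_pair_law// PW// muleC.
pose phi z := \int[lebesgue_measure]_(w in xsection S z) (g2 w)%:E.
have mphi : measurable_fun [set: measurableTypeR R * measurableTypeR R] phi.
  exact: measurable_integral_xsection.
have phi0 z : 0 <= phi z by apply: integral_ge0 => w _; rewrite lee_fin.
under eq_integral.
  move=> w _; rewrite PW; last exact: measurable_xsection.
  rewrite first_coin_true muleC; have [_ _ ->] := W_law; last first.
    exact: measurable_xsection.
  over.
have q0 : 0 <= q%:E by rewrite -first_coin_true measure_ge0.
rewrite ge0_integralZl//;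
  [|exact: (measurableT_comp mphi mX)|by move=> w _; exact: (phi0 (sigma w, V w))].
by rewrite (ge0_integral_has_density mX first_pair_has_density mphi).
Qed.

(** The pair is split according to the coin.  An inequality is enough: the two
    sides have the same total mass, so it is in fact an equality.  The
    right-hand side is first restricted to positive idle periods, where
    [first_observationE] reads off the effect of the coin, and the events on
    the left lose only a null set by the same restriction. *)
Lemma first_observation_law (f1 : R * R -> R)
    (B : set (measurableTypeR R * measurableTypeR R)) :
  has_density P (lebesgue2 R) (observation U 1) f1 -> measurable B ->
  (1 - q)%:E * \int[lebesgue2 R]_(z in B) (f0 z)%:E +
  q%:E * \int[lebesgue2 R]_z (\int[lebesgue_measure]_(w in
     xsection (delayed_event B) z) (g2 w)%:E * (f0 z)%:E) <=
  \int[lebesgue2 R]_(z in B) (f1 z)%:E.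
Proof.
move=> [mf1 f1_ge0 obs_law] mB.
have [m1 m0] : measurable [set 1%R : R] /\ measurable [set 0%R : R] by [].
pose S := delayed_event B.
have mS : measurable S by exact: measurable_delayed_event.
pose N := V @^-1` `]-oo, 0%R].
have mN : measurable N by exact: pre.
have PN E : measurable E -> P E = P (E `&` ~` N).
  move=> mE; rewrite -setDE (measureDI P mE mN) -[RHS]adde0; congr (_ + _).
  by apply: (subset_measure0 _ _ _ first_gap_le0) => //; exact: measurableI.
pose E0 := (fun w => (sigma w, V w)) @^-1` B `&` A @^-1` [set 0%R].
pose E1 := (fun w => ((sigma w, V w), W w)) @^-1` S `&` A @^-1` [set 1%R].
have mE0 : measurable E0.
  apply: measurableI; last exact: preA.
  by rewrite -[X in measurable X]setTI; exact: measurable_fun_pair.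
have mE1 : measurable E1.
  apply: measurableI; last exact: preA.
  rewrite -[X in measurable X]setTI; apply: measurable_fun_pair => //.
  exact: measurable_fun_pair.
rewrite -(first_triple_law mS) -/E1.
have -> : (1 - q)%:E * \int[lebesgue2 R]_(z in B) (f0 z)%:E = P E0.
  have := first_pair_law measurableT m0 mB.
  by rewrite preimage_setT setTI probability_setT mul1e first_coin_false => <-.
pose B' := B `&` [set z | 0 < z.2]%R.
have mB' : measurable B'.
  apply: measurableI => //; rewrite -[X in measurable X]setTI.
  rewrite (_ : [set z | (0 < z.2)%R] = snd @^-1` `]0%R, +oo[); last first.
    by apply/seteqP; split => z /=; rewrite in_itv/= andbT.
  exact: measurable_snd.
apply: (@le_trans _ _ (\int[lebesgue2 R]_(z in B') (f1 z)%:E)); last first.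
  apply: ge0_subset_integral => //.
  - by apply/measurable_funTS/measurable_EFinP.
  - by move=> z _; rewrite lee_fin.
  - exact: subIsetl.
have -> : \int[lebesgue2 R]_(z in B') (f1 z)%:E = P (observation U 1 @^-1` B').
  exact/esym/obs_law.
rewrite (PN E0)// (PN E1)//.
rewrite (_ : observation U 1 @^-1` B' = E0 `&` ~` N `|` E1 `&` ~` N).
  have mNC := measurableC mN.
  rewrite measureU//; [exact: measurableI|exact: measurableI|].
  apply/seteqP; split => // w [[[_ /= c0] _] [[_ /= c1] _]].
  by move: c1; rewrite c0 => /eqP; rewrite eq_sym oner_eq0.
rewrite /E0 /E1 /N /B'; apply/seteqP; split => w /=;
  have [_ idleE] := first_observationE w.
  rewrite first_observationE idleE in_itv/= => -[+ V0].
  have nV0 : ~ (V w <= 0)%R by apply/negP; rewrite -ltNge.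
  rewrite V0/=.
  case: (coin U 1 w) => BZ; [right|left] => //.
  split => //; split => //; move: BZ.
  by rewrite sub0r (_ : Num.max _ _ = 0)%R ?addr0//; apply/max_idPl; lra.
rewrite first_observationE idleE in_itv/= => -[] [[+ c] /negP];
  rewrite -ltNge => + V0; rewrite V0/=.
- move: c; case: (coin U 1 w) => /= [/eqP|_ BZ]; first by rewrite oner_eq0.
  by rewrite sub0r (_ : Num.max _ _ = 0)%R ?addr0//; apply/max_idPl; lra.
- by move: c; case: (coin U 1 w) => //= /eqP; rewrite eq_sym oner_eq0.
Qed.

End IEBP.
End queue.

(** * The density of a delayed service time *)

Section translation.
Local Open Scope ereal_scope.
Context (R : realType).
Local Notation mu := (@lebesgue_measure R).

Lemma lebesgue_measure_shift (c : R) (A : set R) : measurable A ->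
  pushforward mu (fun x : R => (x + c)%R : measurableTypeR R) A = mu A.
Proof.
move=> mA; have mc : measurable_fun [set: R] (fun x : R => (x + c)%R).
  exact: measurable_funD.
apply/esym/lebesgue_measure_unique => //= _ [[a b]] _ <-.
rewrite /pushforward (_ : _ @^-1` _ = `](a - c)%R, (b - c)%R]%classic).
  rewrite !lebesgue_measure_itv/= !lte_fin ltrD2r -!EFinB.
  by congr (if _ then _%:E else _); ring.
by apply/seteqP; split => x /=; rewrite !in_itv/= ltrBlDr lerBrDr.
Qed.

Lemma ge0_integral_shift (f : R -> \bar R) (c : R) :
  measurable_fun [set: R] f -> (forall x, 0 <= f x) ->
  \int[mu]_x f (x + c)%R = \int[mu]_x f x.
Proof.
move=> mf f0; have mc : measurable_fun [set: R] (fun x : R => (x + c)%R).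
  exact: measurable_funD.
have mc' : measurable_fun [set: measurableTypeR R]
  (fun x : measurableTypeR R => (x + c)%R : measurableTypeR R) := mc.
rewrite -[LHS](ge0_integral_pushforward mc' mu measurableT)//.
by apply: eq_measure_integral => A mA _; exact: lebesgue_measure_shift.
Qed.

End translation.

Section delayed_service.
Local Open Scope ereal_scope.
Context (R : realType) (g1 g2 : R -> R).
Local Notation mu := (@lebesgue_measure R).
Hypotheses (mg1 : measurable_fun [set: R] g1) (mg2 : measurable_fun [set: R] g2).
Hypotheses (g1_ge0 : forall x, (0 <= g1 x)%R) (g2_ge0 : forall x, (0 <= g2 x)%R).
Hypotheses (g1_neg : forall x, (x < 0)%R -> g1 x = 0%R)
  (g2_neg : forall x, (x < 0)%R -> g2 x = 0%R).

(** For [v >= 0], the part of the density at [y] of [sigma1 + (sigma2 - v)^+]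
    that comes from the event [sigma2 >= v]. *)
Definition delay_convolution (y v : R) : \bar R :=
  \int[mu]_(u in `[0%R, y]) (g1 u * g2 (v + y - u))%:E.

Definition service_cdf (v : R) : \bar R := \int[mu]_(u in `[0%R, v]) (g2 u)%:E.

Lemma delay_convolution_ge0 y v : 0 <= delay_convolution y v.
Proof. by apply: integral_ge0 => u _; rewrite lee_fin mulr_ge0. Qed.

Lemma service_cdf_ge0 v : 0 <= service_cdf v.
Proof. by apply: integral_ge0 => u _; rewrite lee_fin. Qed.

Let measurable_le_pair d (E : measurableType d) (f h : E -> R) :
  measurable_fun [set: E] f -> measurable_fun [set: E] h ->
  measurable [set z | (f z <= h z)%R].
Proof.
move=> mf mh; rewrite -[X in measurable X]setTI.
rewrite (_ : [set z | _] = (fun z => f z <= h z)%R @^-1` [set true]).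
  exact: measurable_fun_ler.
by rewrite preimage_true.
Qed.

Lemma measurable_integral_itv d (E : measurableType d) (h : E -> R)
    (f : E * measurableTypeR R -> R) :
  measurable_fun [set: E] h -> measurable_fun [set: E * measurableTypeR R] f ->
  (forall x, 0 <= f x)%R ->
  measurable_fun [set: E] (fun z => \int[mu]_(u in `[0%R, h z]) (f (z, u))%:E).
Proof.
move=> mh mf f0.
pose S := [set x : E * measurableTypeR R | 0 <= x.2]%R `&`
  [set x | x.2 <= h x.1]%R.
have mS : measurable S.
  apply: measurableI; apply: measurable_le_pair => //.
  exact: measurableT_comp.
have mfS : measurable_fun [set: E * measurableTypeR R]
    (fun x => (f x * \1_S x)%:E).
  by apply/measurable_EFinP/measurable_funM.
rewrite (_ : (fun z => _) = fun z => \int[mu]_u (f (z, u) * \1_S (z, u))%:E).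
  apply: (@measurable_fun_fubini_tonelli_F _ _ _ _ _ mu
    (fun x => (f x * \1_S x)%:E)) => //.
  by move=> x; rewrite lee_fin mulr_ge0.
apply/funext => z; rewrite -integral_Mindic//; apply: eq_integral => u _.
rewrite !indicE; congr (_ * (_ : bool)%:R)%:E.
by apply/idP/idP; rewrite !inE /S/= in_itv/= => /andP.
Qed.

Lemma measurable_delay_convolution :
  measurable_fun [set: measurableTypeR R * measurableTypeR R]
    (fun z => delay_convolution z.1 z.2).
Proof.
apply: (measurable_integral_itv
  (f := fun x : measurableTypeR R * measurableTypeR R * measurableTypeR R =>
     g1 x.2 * g2 (x.1.2 + x.1.1 - x.2))%R) => //.
- apply: measurable_funM; first exact: measurableT_comp.
  apply: (measurableT_comp mg2); apply: measurable_funB => //.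
  by apply: measurable_funD; exact: measurableT_comp.
- by move=> x; rewrite mulr_ge0.
Qed.

Lemma measurable_service_cdf : measurable_fun [set: R] service_cdf.
Proof.
apply: (measurable_integral_itv (E := measurableTypeR R)
  (f := fun x : measurableTypeR R * measurableTypeR R => g2 x.2)) => //.
exact: measurableT_comp.
Qed.

Lemma integral_service_before v (a : R) : (0 <= v)%R -> (0 <= a)%R ->
  \int[mu]_w (a * (g2 w * \1_(`]-oo, v[) w))%:E = a%:E * service_cdf v.
Proof.
move=> v0 a0.
under eq_integral do rewrite EFinM.
have mi : measurable_fun [set: R] (fun w => g2 w * \1_(`]-oo, v[) w)%R.
  by apply: measurable_funM.
rewrite ge0_integralZl_EFin//; last 2 first.
- by move=> w _; rewrite lee_fin mulr_ge0.
- exact/measurable_EFinP.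
congr (_ * _); rewrite integral_Mindic// /service_cdf.
rewrite -integral_itv_bndo_bndc; last exact/measurable_funTS/measurable_EFinP.
rewrite integral_mkcond [RHS]integral_mkcond; apply: eq_integral => w _.
rewrite !patchE !mem_setE !in_itv/=; have [w0|w0] := ltP w 0%R => //=.
by rewrite g2_neg//; case: ifP.
Qed.

(** Alice's job is over before [v], and leaves the service time unchanged, or
    it lasts [w >= v] and translates it by [w - v]; in the second case the
    substitution [w = y - u + v] and Tonelli's theorem produce the
    convolution. *)
Lemma delayed_service_law v (A : set R) : (0 <= v)%R -> measurable A ->
  \int[mu]_u ((g1 u)%:E *
    \int[mu]_(w in [set w | A (u + Num.max 0 (w - v))%R]) (g2 w)%:E) =
  \int[mu]_(y in A) (delay_convolution y v + (g1 y)%:E * service_cdf v).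
Proof.
move=> v0 mA.
have mge : measurable [set t : R | 0 <= t]%R.
  by rewrite -[X in measurable X](set_itvcy (0 : R)%R)/=; exact: measurable_itv.
have mIA : measurable_fun [set: R] (\1_A : R -> R) by exact: measurable_indic.
have mIge : measurable_fun [set: R] (\1_[set t : R | 0 <= t]%R : R -> R).
  exact: measurable_indic.
pose F (z : R * R) := (g1 z.1 *
  (g2 (v + z.2 - z.1) * (\1_[set t | 0 <= t]%R (z.2 - z.1) * \1_A z.2)))%:E.
have mshift : measurable_fun [set: measurableTypeR R * measurableTypeR R]
    (fun z => v + z.2 - z.1)%R.
  by apply: measurable_funB => //; exact: measurable_funD.
have mF : measurable_fun [set: measurableTypeR R * measurableTypeR R] F.
  apply/measurable_EFinP; apply: measurable_funM; first exact: measurableT_comp.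
  apply: measurable_funM; first exact: (measurableT_comp mg2 mshift).
  apply: measurable_funM; last first.
    exact: (measurableT_comp mIA measurable_snd).
  by apply: (measurableT_comp mIge); exact: measurable_funB.
have F0 z : 0 <= F z by rewrite lee_fin !mulr_ge0.
have splitE u : (g1 u)%:E *
    \int[mu]_(w in [set w | A (u + Num.max 0 (w - v))%R]) (g2 w)%:E =
  (g1 u * \1_A u)%:E * service_cdf v + \int[mu]_y F (u, y).
  have mAu : measurable [set w : R | A (u + Num.max 0 (w - v))%R].
    rewrite -[X in measurable X]setTI; apply: (_ : measurable_fun _
      (fun w : R => (u + Num.max 0 (w - v))%R)) => //.
    apply: measurable_funD => //; apply: measurable_maxr => //.
    exact: measurable_funB.
  rewrite -integral_service_before ?mulr_ge0//.
  rewrite -(@ge0_integral_shift _ (fun y => F (u, y)) (u - v)%R)//; last first.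
    exact: (measurable_fun_pair2 u mF).
  have mFu : measurable_fun [set: R] (fun w => F (u, w + (u - v)))%R.
    apply: (measurableT_comp (measurable_fun_pair2 u mF)).
    exact: measurable_funD.
  rewrite -integral_Mindic// -ge0_integralZl_EFin//; last 2 first.
  - by move=> w _; rewrite lee_fin mulr_ge0.
  - by apply/measurable_EFinP/measurable_funM.
  rewrite -ge0_integralD//; last 2 first.
  - by move=> w _; rewrite lee_fin !mulr_ge0.
  - by apply/measurable_EFinP; do 2 (apply: measurable_funM => //).
  apply: eq_integral => w _; rewrite /F /= -EFinM -EFinD; congr _%:E.
  rewrite (_ : v + (w + (u - v)) - u = w)%R; last by ring.
  rewrite (_ : w + (u - v) - u = w - v)%R; last by ring.
  have -> : \1_[set t | A (u + Num.max 0 (t - v))%R] w =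
      \1_A (u + Num.max 0 (w - v))%R :> R.
    by rewrite !indicE; congr ((_ : bool)%:R); apply/idP/idP; rewrite !inE.
  have [wv|vw] := ltP w v.
    rewrite (_ : Num.max 0 (w - v) = 0)%R; last by apply/max_idPl; lra.
    rewrite [\1_`]-oo, v[ w]indicE mem_set/= ?in_itv//.
    rewrite [\1_[set t | _] _]indicE memNset/=; last by lra.
    by rewrite addr0; ring.
  rewrite (_ : Num.max 0 (w - v) = w - v)%R; last by apply/max_idPr; lra.
  rewrite [\1_`]-oo, v[ w]indicE memNset/=; last by rewrite in_itv/=; lra.
  rewrite [\1_[set t | _] _]indicE mem_set/=; last by lra.
  by rewrite (_ : u + (w - v) = w + (u - v))%R; ring.
under eq_integral do rewrite splitE.
rewrite ge0_integralD//=; last 4 first.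
- by move=> u _; rewrite mule_ge0 ?lee_fin ?mulr_ge0// service_cdf_ge0.
- apply: emeasurable_funM => //; apply/measurable_EFinP.
  exact: measurable_funM.
- by move=> u _; exact: integral_ge0.
- exact: (@measurable_fun_fubini_tonelli_F _ _ _ _ _ mu F).
have FE y : \int[mu]_u F (u, y) = (\1_A y)%:E * delay_convolution y v.
  have mFy : measurable_fun [set: R]
      (fun u => g1 u * g2 (v + y - u) * \1_(`[0%R, y]) u)%R.
    apply: measurable_funM => //; apply: measurable_funM => //.
    by apply: (measurableT_comp mg2); exact: measurable_funB.
  have -> : delay_convolution y v =
      \int[mu]_u (g1 u * g2 (v + y - u) * \1_(`[0%R, y]) u)%:E.
    by rewrite integral_Mindic.
  rewrite -ge0_integralZl_EFin//; last 2 first.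
  - by move=> u _; rewrite lee_fin !mulr_ge0.
  - exact/measurable_EFinP.
  apply: eq_integral => u _; rewrite /F /= -EFinM; congr _%:E.
  have [u0|u0] := ltP u 0%R; first by rewrite g1_neg// !(mul0r, mulr0).
  rewrite (_ : \1_[set t | 0 <= t]%R (y - u) = \1_`[0%R, y] u :> R)%R.
    by ring.
  rewrite !indicE; congr ((_ : bool)%:R).
  by apply/idP/idP; rewrite !inE /= in_itv/= u0/= subr_ge0.
have mconv : measurable_fun [set: R] (delay_convolution ^~ v).
  exact: (measurable_fun_pair1 v measurable_delay_convolution).
rewrite [RHS]ge0_integralD//; last 4 first.
- by move=> y _; exact: delay_convolution_ge0.
- exact: measurable_funTS.
- by move=> y _; rewrite mule_ge0 ?lee_fin// service_cdf_ge0.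
- apply: emeasurable_funM => //.
  by apply/measurable_funTS/measurable_EFinP.
rewrite [RHS]addeC; congr (_ + _).
  rewrite [RHS]integral_mkcond; apply: eq_integral => y _.
  by rewrite patchE indicE; case: (_ \in _); rewrite ?mulr1 ?mulr0 ?mul0e.
transitivity (\int[mu]_y \int[mu]_u F (u, y)).
  exact: (sfinite_Fubini mu mu F F0 mF).
transitivity (\int[mu]_y ((\1_A y)%:E * delay_convolution y v)).
  by apply: eq_integral => y _; exact: FE.
rewrite [RHS]integral_mkcond; apply: eq_integral => y _.
by rewrite patchE indicE; case: (_ \in _); rewrite ?mul1e ?mul0e.
Qed.

End delayed_service.

(** * The mixture and the perturbed density *)

Section perturbation.
Local Open Scope ereal_scope.
Context (R : realType) (lam : R) (g1 g2 : R -> R).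
Local Notation mu := (@lebesgue_measure R).
Local Notation MR := (measurableTypeR R).
Hypothesis lam_gt0 : (0 < lam)%R.
Hypotheses (mg1 : measurable_fun [set: R] g1) (mg2 : measurable_fun [set: R] g2).
Hypotheses (g1_ge0 : forall x, (0 <= g1 x)%R) (g2_ge0 : forall x, (0 <= g2 x)%R).
Hypotheses (g1_neg : forall x, (x < 0)%R -> g1 x = 0%R)
  (g2_neg : forall x, (x < 0)%R -> g2 x = 0%R).

Local Notation f0 := (null_density g1 lam).
Local Notation e := (exponential_pdf lam).

Let e_ge0 v : (0 <= e v)%R.
Proof. by rewrite exponential_pdf_ge0// ltW. Qed.

Let me : measurable_fun [set: R] e.
Proof. exact: measurable_exponential_pdf. Qed.

Let f0_ge0 z : (0 <= f0 z)%R.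
Proof. by rewrite mulr_ge0. Qed.

Lemma measurable_null_density : measurable_fun [set: MR * MR] f0.
Proof. by apply: measurable_funM; exact: measurableT_comp. Qed.

Lemma measurable_rho : measurable_fun [set: MR * MR] (fun z => rho g1 g2 z.1 z.2).
Proof.
apply: measurable_funB.
  apply: measurable_funM.
    (* as a power, the inverse is covered by measurability of [powR] *)
    rewrite (_ : (fun z => (g1 z.1)^-1)%R =
        fun z : MR * MR => powR (g1 z.1) (-1)%R).
      apply: (measurableT_comp (measurable_powR (-1))).
      exact: measurableT_comp.
    by apply/funext => z; rewrite powR_inv1.
  apply: (measurableT_comp (fine_measurable measurableT)).
  exact: measurable_delay_convolution.
apply: measurable_funB => //.
apply: (measurableT_comp (fine_measurable measurableT)) => //.
apply: (measurableT_comp (measurable_service_cdf mg2 g2_ge0)) => //.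
Qed.

(** The density of the observed pair when Alice inserts a job. *)
Definition delayed_density (z : MR * MR) : \bar R :=
  (e z.2)%:E * (delay_convolution g1 g2 z.1 z.2 + (g1 z.1)%:E * service_cdf g2 z.2).

Lemma delayed_density_ge0 z : 0 <= delayed_density z.
Proof.
by rewrite mule_ge0 ?lee_fin// adde_ge0 ?delay_convolution_ge0 ?mule_ge0 ?lee_fin
  ?service_cdf_ge0.
Qed.

Lemma measurable_delayed_density : measurable_fun [set: MR * MR] delayed_density.
Proof.
apply: emeasurable_funM.
  by apply/measurable_EFinP; exact: measurableT_comp.
apply: emeasurable_funD; first exact: measurable_delay_convolution.
apply: emeasurable_funM.
  by apply/measurable_EFinP; exact: measurableT_comp.
exact: (measurableT_comp (measurable_service_cdf mg2 g2_ge0)).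
Qed.

(** For a fixed idle period this is [delayed_service_law]. *)
Lemma delayed_pair_law (B : set (MR * MR)) : measurable B ->
  \int[lebesgue2 R]_z (\int[mu]_(w in xsection (delayed_event B) z) (g2 w)%:E
    * (f0 z)%:E) =
  \int[lebesgue2 R]_(z in B) delayed_density z.
Proof.
move=> mB; rewrite [RHS]integral_mkcond.
pose phi z := \int[mu]_(w in xsection (delayed_event B) z) (g2 w)%:E.
have mphi : measurable_fun [set: MR * MR] phi.
  by apply: measurable_integral_xsection => //; exact: measurable_delayed_event.
have phi0 z : 0 <= phi z by apply: integral_ge0 => w _; rewrite lee_fin.
have ml : measurable_fun [set: MR * MR] (fun z => phi z * (f0 z)%:E).
  apply: emeasurable_funM => //; apply/measurable_EFinP.
  exact: measurable_null_density.
have mr : measurable_fun [set: MR * MR] (delayed_density \_ B).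
  apply/(measurable_restrictT _ mB)/measurable_funTS.
  exact: measurable_delayed_density.
have r0 z : 0 <= (delayed_density \_ B) z.
  by apply: erestrict_ge0 => ? _; exact: delayed_density_ge0.
have l0 z : 0 <= phi z * (f0 z)%:E by rewrite mule_ge0// lee_fin.
transitivity (\int[mu]_v \int[mu]_u (phi (u, v) * (f0 (u, v))%:E)).
  by rewrite /lebesgue2 fubini_tonelli2.
transitivity (\int[mu]_v \int[mu]_u (delayed_density \_ B) (u, v)); last first.
  by rewrite /lebesgue2 fubini_tonelli2.
apply: eq_integral => v _; have [v0|v0] := ltP v 0%R.
  rewrite !integral0_eq// => u _.
    rewrite patchE; case: ifP => // _.
    by rewrite /delayed_density/= lt0_exponential_pdf// mul0e.
  by rewrite /null_density/= lt0_exponential_pdf// mulr0 mule0.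
have mBv : measurable (ysection B v) by exact: measurable_ysection.
have mphiv := measurable_fun_pair1 v mphi.
transitivity ((e v)%:E * \int[mu]_u ((g1 u)%:E * phi (u, v))).
  rewrite -ge0_integralZl_EFin//; last 2 first.
  - by move=> u _; rewrite mule_ge0// lee_fin.
  - by apply: emeasurable_funM => //; exact/measurable_EFinP.
  apply: eq_integral => u _; rewrite /null_density/= EFinM [LHS]muleC.
  by rewrite [X in X * _ = _]muleC -muleA.
transitivity ((e v)%:E * \int[mu]_(y in ysection B v)
    (delay_convolution g1 g2 y v + (g1 y)%:E * service_cdf g2 v)).
  by congr (_ * _); rewrite -delayed_service_law.
rewrite -ge0_integralZl_EFin//; last 2 first.
- move=> y _.
  by rewrite adde_ge0 ?delay_convolution_ge0 ?mule_ge0 ?lee_fin ?service_cdf_ge0.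
- apply: measurable_funTS; apply: emeasurable_funD.
    exact: (measurable_fun_pair1 v
      (measurable_delay_convolution mg1 mg2 g1_ge0 g2_ge0)).
  by apply: emeasurable_funM => //; exact/measurable_EFinP.
rewrite integral_mkcond; apply: eq_integral => y _.
by rewrite !patchE mem_ysection.
Qed.

Definition perturbed_density (q : R) (z : MR * MR) : R :=
  (f0 z * (1 + q * rho g1 g2 z.1 z.2))%R.

Lemma measurable_perturbed_density q :
  measurable_fun [set: MR * MR] (perturbed_density q).
Proof.
apply: measurable_funM; first exact: measurable_null_density.
apply: measurable_funD => //; apply: measurable_funM => //.
exact: measurable_rho.
Qed.

Lemma perturbed_densityE q z : g1 z.1 != 0%R ->
  perturbed_density q z = ((1 - q) * f0 z + q * (e z.2 *
    (fine (delay_convolution g1 g2 z.1 z.2) +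
     g1 z.1 * fine (service_cdf g2 z.2))))%R.
Proof.
move=> g10; rewrite /perturbed_density /null_density /rho /tail /Rintegral.
by rewrite -/(delay_convolution g1 g2 z.1 z.2) -/(service_cdf g2 z.2); field.
Qed.

Lemma perturbed_density_ge0 q z : (0 <= q <= 1)%R -> (0 <= perturbed_density q z)%R.
Proof.
move=> /andP[q0 q1]; have [g10|g10] := eqVneq (g1 z.1) 0%R.
  by rewrite /perturbed_density /null_density g10 !mul0r.
rewrite perturbed_densityE// addr_ge0// mulr_ge0 ?subr_ge0// mulr_ge0//.
by rewrite addr_ge0 ?mulr_ge0// fine_ge0 ?delay_convolution_ge0 ?service_cdf_ge0.
Qed.

(** There is equality where [g1] does not vanish and the integrals are finite.
    Elsewhere the left-hand side can only be smaller: the real-valued integrals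
    in [rho] are 0 where the extended ones are infinite, and [f0] is 0 where
    [g1] vanishes. *)
Lemma perturbed_density_le q z : (0 <= q <= 1)%R ->
  (perturbed_density q z)%:E <=
  (1 - q)%:E * (f0 z)%:E + q%:E * delayed_density z.
Proof.
move=> /andP[q0 q1]; have [g10|g10] := eqVneq (g1 z.1) 0%R.
  rewrite /perturbed_density /null_density g10 !mul0r.
  by rewrite mule0 add0e mule_ge0 ?lee_fin// delayed_density_ge0.
have le_fineK x : 0 <= x -> (fine x)%:E <= x by case: x.
rewrite perturbed_densityE// EFinD !EFinM leeD2l// lee_wpmul2l ?lee_fin//.
rewrite lee_wpmul2l ?lee_fin// EFinD leeD ?le_fineK ?delay_convolution_ge0//.
by rewrite EFinM lee_wpmul2l ?lee_fin// le_fineK ?service_cdf_ge0.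
Qed.

Lemma le_integral_mixture q (B : set (MR * MR)) : (0 <= q <= 1)%R -> measurable B ->
  \int[lebesgue2 R]_(z in B) (perturbed_density q z)%:E <=
  (1 - q)%:E * \int[lebesgue2 R]_(z in B) (f0 z)%:E +
  q%:E * \int[lebesgue2 R]_(z in B) delayed_density z.
Proof.
move=> q01 mB; have /andP[q0 q1] := q01.
have q1' : (0 <= 1 - q)%R by rewrite subr_ge0.
have mf0 := measurable_null_density.
have md := measurable_delayed_density.
rewrite /lebesgue2 -!ge0_integralZl_EFin//; last 4 first.
- by move=> z _; exact: delayed_density_ge0.
- exact: measurable_funTS.
- by move=> z _; rewrite lee_fin.
- exact/measurable_funTS/measurable_EFinP.
rewrite -ge0_integralD//; last 4 first.
- by move=> z _; rewrite mule_ge0 ?lee_fin.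
- by apply: emeasurable_funM => //; exact/measurable_funTS/measurable_EFinP.
- by move=> z _; rewrite mule_ge0 ?lee_fin ?delayed_density_ge0.
- by apply: emeasurable_funM => //; exact: measurable_funTS.
apply: ge0_le_integral => //.
- by move=> z _; rewrite lee_fin perturbed_density_ge0.
- by apply/measurable_funTS/measurable_EFinP; exact: measurable_perturbed_density.
- apply: emeasurable_funD; apply: emeasurable_funM => //.
    exact/measurable_funTS/measurable_EFinP.
  exact: measurable_funTS.
- by move=> z _; exact: perturbed_density_le.
Qed.

End perturbation.

(** * Total variation bounds and conclusion *)

Section total_variation_bounds.
Local Open Scope ereal_scope.
Context (R : realType) d (E : measurableType d) (nu : {measure set E -> \bar R}).
Implicit Types (f r : E -> R) (q c C : R) (n : nat).

Lemma tv_distance_le_mixture (f0 f1 : E -> R) q n :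
  measurable_fun [set: E] f0 -> measurable_fun [set: E] f1 ->
  (forall x, 0 <= f0 x)%R -> (forall x, 0 <= f1 x)%R ->
  \int[nu]_x (f0 x)%:E = 1 -> \int[nu]_x (f1 x)%:E = 1 ->
  (0 <= q <= 1)%R ->
  (forall B, measurable B ->
    (1 - q)%:E * \int[nu]_(x in B) (f0 x)%:E <= \int[nu]_(x in B) (f1 x)%:E) ->
  tv_distance nu (tensor_density f0 (n := n)) (tensor_density f1 (n := n)) <=
  (n%:R * q)%:E.
Proof.
move=> mf0 mf1 f0_ge0 f1_ge0 if0 if1 q01 f0f1.
have idiff := integral_abs_diff_le mf0 mf1 f0_ge0 f1_ge0 if0 if1 q01 f0f1.
have q2 : (0 <= 2 * q)%R by rewrite mulr_ge0//; case/andP: q01.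
have := integral_tensor_diff_le n 1 mf0 mf1 f0_ge0 f1_ge0 if0 if1 idiff q2 ler01.
under eq_fun do rewrite !mul1r; rewrite subrr normr0 add0r mul1r => le_n.
apply: (@le_trans _ _ (2^-1%:E * (2 * q *+ n)%:E)).
  by rewrite lee_wpmul2l// lee_fin invr_ge0.
by rewrite -EFinM lee_fin -(mulr_natl (2 * q)) mulrCA mulKf.
Qed.

Lemma integrable_density (f0 : E -> R) :
  measurable_fun [set: E] f0 -> (forall x, 0 <= f0 x)%R ->
  \int[nu]_x (f0 x)%:E = 1 -> nu.-integrable [set: E] (fun x => (f0 x)%:E).
Proof.
move=> mf0 f0_ge0 if0; apply/integrableP; split; first exact/measurable_EFinP.
by under eq_integral do rewrite /= ger0_norm//; rewrite if0 ltry.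
Qed.

(** Here [f0 (1 + q r)] is a perturbation of the density [f0] by a score [r] of
    mean 0 and second moment [C] under [f0]. *)
Section tilting.
Context (f0 r : E -> R) (C : R).
Hypotheses (mf0 : measurable_fun [set: E] f0) (mr : measurable_fun [set: E] r).
Hypotheses (f0_ge0 : forall x, (0 <= f0 x)%R).
Hypotheses (if0 : \int[nu]_x (f0 x)%:E = 1)
  (ir : \int[nu]_x (r x * f0 x)%:E = 0)
  (ir2 : \int[nu]_x (r x ^+ 2 * f0 x)%:E = C%:E).

Let int0 := integrable_density mf0 f0_ge0 if0.

Let int2 : nu.-integrable [set: E] (fun x => (r x ^+ 2 * f0 x)%:E).
Proof.
apply/integrableP; split.
  by apply/measurable_EFinP; apply: measurable_funM => //; exact: measurable_funX.
rewrite (eq_integral (fun x => (r x ^+ 2 * f0 x)%:E)) ?ir2 ?ltry// => x _.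
by rewrite /= ger0_norm// mulr_ge0// sqr_ge0.
Qed.

(* [|r| <= 1 + r^2] *)
Let int1 : nu.-integrable [set: E] (fun x => (r x * f0 x)%:E).
Proof.
apply: (@le_integrable _ _ _ nu setT measurableT _
  (fun x => (f0 x)%:E + (r x ^+ 2 * f0 x)%:E)).
- by apply/measurable_EFinP; exact: measurable_funM.
- move=> x _; rewrite /= lee_fin normrM (ger0_norm (f0_ge0 x)).
  rewrite -{2}[f0 x]mul1r -mulrDl [leRHS]ger0_norm; last first.
    by rewrite mulr_ge0// addr_ge0// sqr_ge0.
  rewrite ler_wpM2r//; have := sqr_ge0 (1 - `|r x|)%R.
  rewrite sqrrB expr1n real_normK ?num_real//.
  have := normr_ge0 (r x); lra.
- exact: integrableD.
Qed.

Lemma integral_tilt q :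
  nu.-integrable [set: E] (fun x => (f0 x * (1 + q * r x))%:E) /\
  \int[nu]_x (f0 x * (1 + q * r x))%:E = 1.
Proof.
have lE : (fun x => (f0 x * (1 + q * r x))%:E) =
    (fun x => (f0 x)%:E + q%:E * (r x * f0 x)%:E).
  by apply/funext => x; rewrite -EFinM -EFinD; congr _%:E; ring.
rewrite lE; split; first by apply: integrableD => //; exact: integrableZl.
rewrite integralD//; last exact: integrableZl.
by rewrite integralZl// if0 ir mule0 adde0.
Qed.

Lemma integral_tilt_sqr q :
  nu.-integrable [set: E] (fun x => (f0 x * (1 + q * r x) ^+ 2)%:E) /\
  \int[nu]_x (f0 x * (1 + q * r x) ^+ 2)%:E = (1 + q ^+ 2 * C)%:E.
Proof.
have lE : (fun x => (f0 x * (1 + q * r x) ^+ 2)%:E) =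
    (fun x => (f0 x)%:E +
      ((2 * q)%:E * (r x * f0 x)%:E + (q ^+ 2)%:E * (r x ^+ 2 * f0 x)%:E)).
  by apply/funext => x; rewrite -!EFinM -!EFinD; congr _%:E; ring.
have intZ (k : R) h : nu.-integrable [set: E] h ->
  nu.-integrable [set: E] (fun x => k%:E * h x) by exact: integrableZl.
have intD : nu.-integrable [set: E] (fun x =>
    (2 * q)%:E * (r x * f0 x)%:E + (q ^+ 2)%:E * (r x ^+ 2 * f0 x)%:E).
  by apply: integrableD => //; exact: intZ.
rewrite lE; split; first exact: integrableD.
rewrite integralD// integralD//; [|exact: intZ|exact: intZ].
by rewrite !integralZl// if0 ir ir2 mule0 add0e EFinD EFinM.
Qed.

Lemma tv_distance_le_chi2 (f1 : E -> R) q c n :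
  {ae nu, forall x, f1 x = f0 x * (1 + q * r x)}%R -> (0 < c)%R ->
  tv_distance nu (tensor_density f0 (n := n)) (tensor_density f1 (n := n)) <=
  ((c + ((1 + q ^+ 2 * C) ^+ n - 1) / c) / 4)%:E.
Proof.
move=> f1E c0.
have C0 : (0 <= C)%R.
  rewrite -lee_fin -ir2; apply: integral_ge0 => x _.
  by rewrite lee_fin mulr_ge0// sqr_ge0.
have ml : measurable_fun [set: E] (fun x => 1 + q * r x)%R.
  by apply: measurable_funD => //; exact: measurable_funM.
have [intl il] := integral_tilt q.
have [intl2 il2] := integral_tilt_sqr q.
have s1 : (1 <= 1 + q ^+ 2 * C)%R by rewrite lerDl mulr_ge0// sqr_ge0.
have := integral_tensor_chi2_le n 1 mf0 ml f0_ge0 f1E int0 intl intl2 if0 il il2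
  s1 c0 ler01.
under eq_fun do rewrite !mul1r.
rewrite mul1r expr1n mul1r mulr1 => le_n.
apply: (@le_trans _ _ (2^-1%:E *
  ((c ^+ 2 + 1 + (1 + q ^+ 2 * C) ^+ n - 2) / (2 * c))%:E)).
  by apply: lee_wpmul2l => //; rewrite lee_fin invr_ge0.
rewrite -EFinM lee_fin le_eqVlt; apply/orP; left; apply/eqP.
by field; rewrite gt_eqF.
Qed.

End tilting.

End total_variation_bounds.

Theorem proposition5p1 (R : realType) (lam mu1 mu2 : R) (g1 g2 : R -> R)
  (lam_gt0 : 0 < lam) (mu1_gt0 : 0 < mu1) (mu2_gt0 : 0 < mu2)
  (stable : lam / mu1 < 1)
  (hg1 : service_density g1 mu1^-1) (hg2 : service_density g2 mu2^-1)
  (d : measure_display) (Omega : measurableType d) (U : queue_inputs Omega R)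
  (P : R -> probability Omega R)
  (hP : forall q : R, 0 <= q <= 1 -> IEBP_law U (P q) lam g1 g2 q)
  (f1 : R -> R * R -> R)
  (hf1 : forall q : R, 0 <= q <= 1 -> forall j : nat, (1 <= j)%N ->
     has_density (P q) (lebesgue2 R) (observation U j) (f1 q))
  (d' : measure_display) (Omega' : measurableType d')
  (Q : probability Omega' R) (X V : {RV Q >-> R})
  (hXV : has_density Q (lebesgue2 R) (fun w => (X w, V w))
           (null_density g1 lam))
  (C0_fin : ('E_Q[fun w => (rho g1 g2 (X w) (V w) ^+ 2)%R] < +oo)%E) :
  (('E_Q[fun w => (rho g1 g2 (X w) (V w))%R] = 0)%E ->
     covertly_inserts_bigO (null_density g1 lam) f1
       (fun n : nat => Num.sqrt n%:R)) /\
  (('E_Q[fun w => (rho g1 g2 (X w) (V w))%R] <> 0)%E ->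
     covertly_inserts_bigO (null_density g1 lam) f1 (fun _ : nat => 1)).
Proof.
have q00 : 0 <= (0 : R) <= (1 : R) by rewrite lexx ler01.
have [mg1 g1_ge0 _] := wservice_law (hP _ q00) (leqnn 1).
have [mg2 g2_ge0 _] := aservice_law (hP _ q00) (leqnn 1).
have g1_neg := service_density_neg hg1.
have g2_neg := service_density_neg hg2.
pose f0 := null_density g1 lam.
have [mf0 f0_ge0 _] := hXV.
have if0 := has_density_mass hXV.
have f1_law q (q01 : 0 <= q <= 1) := hf1 _ q01 _ (leqnn 1).
have mixture q B : 0 <= q <= 1 -> measurable B ->
    ((1 - q)%:E * \int[lebesgue2 R]_(z in B) (f0 z)%:E +
     q%:E * \int[lebesgue2 R]_(z in B) delayed_density lam g1 g2 z <=
     \int[lebesgue2 R]_(z in B) (f1 q z)%:E)%E.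
  move=> q01 mB; rewrite -delayed_pair_law//.
  exact: (first_observation_law lam_gt0 (hP _ q01) (f1_law _ q01)).
split=> [rho_mean0|_].
- have mXV : measurable_fun [set: Omega']
      (fun w => (X w, V w) : measurableTypeR R * measurableTypeR R).
    exact: measurable_fun_pair (measurable_funP X) (measurable_funP V).
  have mrho := measurable_rho mg1 mg2 g1_ge0 g2_ge0.
  pose r (z : R * R) := rho g1 g2 z.1 z.2.
  have ir : (\int[lebesgue2 R]_z (r z * f0 z)%:E = 0)%E.
    by rewrite -(integral_has_density mXV hXV mrho) -rho_mean0 unlock.
  have mrho2 : measurable_fun [set: measurableTypeR R * measurableTypeR R]
      (fun z => r z ^+ 2) by exact: measurable_funX.
  have := integral_has_density mXV hXV mrho2.
  move: C0_fin; rewrite unlock => /[swap] -> ir2_fin.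
  have ir2_fin_num : (\int[lebesgue2 R]_z (r z ^+ 2 * f0 z)%:E)%E \is a fin_num.
    rewrite ge0_fin_numE//; apply: integral_ge0 => z _.
    by rewrite lee_fin mulr_ge0// sqr_ge0.
  apply: (covertly_inserts_bigO_sqrt
    (C := fine (\int[lebesgue2 R]_z (r z ^+ 2 * f0 z)%:E)%E)).
    apply: fine_ge0; apply: integral_ge0 => z _.
    by rewrite lee_fin mulr_ge0// sqr_ge0.
  move=> q n c q01 c0; have [mf1 f1_ge0 _] := f1_law _ q01.
  have ir2 := esym (fineK ir2_fin_num).
  apply: (tv_distance_le_chi2 mf0 mrho f0_ge0 if0 ir ir2 n _ c0).
  have [_ ik] := integral_tilt mf0 mrho f0_ge0 if0 ir ir2 q.
  (* [E rho = 0] gives both densities mass 1, so domination is equality *)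
  apply: (ae_eq_of_le_integral (k := perturbed_density lam g1 g2 q)) => //.
  + exact: measurable_perturbed_density.
  + by move=> z; exact: perturbed_density_ge0.
  + exact: has_density_mass (f1_law _ q01).
  + move=> B mB; apply: le_trans (mixture _ _ q01 mB).
    exact: le_integral_mixture.
- apply: covertly_inserts_bigO1 => q n q01; have [mf1 f1_ge0 _] := f1_law _ q01.
  apply: tv_distance_le_mixture => //.
    exact: has_density_mass (f1_law _ q01).
  move=> B mB; apply: le_trans (mixture _ _ q01 mB).
  rewrite leeDl// mule_ge0 ?lee_fin//; first by case/andP: q01.
  by apply: integral_ge0 => z _; exact: delayed_density_ge0.
Qed.
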